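(* Let $\Lambda$ be an indecomposable, non-hereditary, symmetric $R$-order in $\mathcal A$ with $\Lambda=\Lambda^{\#}$, let $\Gamma:=\mathrm{Id}(J(\Lambda))$ and $\Delta:=\mathrm{Id}(J(\Gamma))$. Let $e_1,\dots,e_h\in\Lambda$ be orthogonal lifts of the central primitive idempotents of $\Lambda/J(\Lambda)$, ordered so that $e_i\Lambda e_i/J(e_i\Lambda e_i)\cong e_i\Gamma e_i/J(e_i\Gamma e_i)$ for $1\le i\le t$ and $J(e_i\Gamma e_i)=J(e_i\Lambda e_i)$ for $t<i\le h$, and put $f:=\sum_{i=t+1}^h e_i$. Then: (a) $f=0$ or $f=1$. (b) If $f=1$, then $J(\Gamma)=J(\Lambda)$ and $\Gamma=\Delta$ is hereditary. (c) If $f=0$, then $\Gamma=J(\Gamma)+\Lambda$, $\Gamma/J(\Gamma)\cong\Lambda/J(\Lambda)$, $J(\Gamma)=J(\Gamma)^{\#}$ and $\Delta=(J(\Gamma)^2)^{\#}$.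
   Context: $R$ is a discrete valuation ring with maximal ideal $\pi R$, residue field $k=R/\pi R$ and field of fractions $K$; $\mathcal A$ is a separable finite dimensional $K$-algebra. An $R$-order in $\mathcal A$ is a subring containing $1_{\mathcal A}$ that is a full $R$-lattice in $\mathcal A$. $J(\cdot)$ is the Jacobson radical. An order is hereditary if each of its left ideals is projective; it is indecomposable if it is not a direct sum of two nonzero two-sided ideals. For a full $R$-lattice $L$ in $\mathcal A$: $O_l(L)=\{a\in\mathcal A: aL\subseteq L\}$, $O_r(L)=\{a\in\mathcal A: La\subseteq L\}$, $\mathrm{Id}(L)=O_l(L)\cap O_r(L)$. For $z\in Z(\mathcal A)^*$ let $\mathrm{Tr}_z(a,b)=\mathrm{tr}_{red}(zab)$ with $\mathrm{tr}_{red}:\mathcal A\to K$ the reduced trace, and for $\phi=\mathrm{Tr}_z$ let $L^{\#}=\{a\in\mathcal A:\phi(L,a)\subseteq R\}$. An $R$-order $\Lambda$ is symmetric if $\Lambda=\Lambda^{\#}$ for some such $\phi$; this $\phi$ is fixed and $\#$ is formed with respect to it. One has $\Gamma=J(\Lambda)^{\#}$. For each $i$ exactly one of the two alternatives used for the ordering holds (the isomorphism in the first alternative is as $e_i\Lambda e_i$-$e_i\Lambda e_i$-bimodules). *)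

(* Defs.v *)
From HB Require Import structures.
From mathcomp Require Import all_boot all_order all_algebra all_field.
From mathcomp Require Import classical_sets.

Set Implicit Arguments.
Unset Strict Implicit.
Unset Printing Implicit Defensive.

Import Order.TTheory GRing.Theory Num.Theory.

Local Open Scope classical_set_scope.
Local Open Scope ring_scope.

(* R is the valuation ring of a discrete valuation v of K, so K is the field
   of fractions of R. The value v 0 is irrelevant. *)
Definition is_dvr (K : fieldType) (R : set K) : Prop :=
  exists v : K -> int,
    [/\ forall x y, x != 0 -> y != 0 -> v (x * y) = v x + v y,
        forall x y, x != 0 -> y != 0 -> x + y != 0 ->
          Num.min (v x) (v y) <= v (x + y),
        forall n : int, exists2 x, x != 0 & v x = n
      & R = [set x | x = 0 \/ 0 <= v x] ].

(* Subrings, ideals and lattices are subsets of an ambient ring. The definitions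
   below do not use the unit element of S, so that they also apply to a corner
   e S e, whose unit element is e. *)
Section Ideals.
Variable A : nzRingType.
Implicit Types (S I J M N L : set A).

Definition additive_subgroup L : Prop :=
  L 0 /\ forall x y, L x -> L y -> L (x - y).

Definition left_ideal S I : Prop :=
  [/\ I `<=` S, additive_subgroup I & forall s x, S s -> I x -> I (s * x)].

Definition twosided_ideal S I : Prop :=
  left_ideal S I /\ forall s x, S s -> I x -> I (x * s).

Definition maximal_left_ideal S M : Prop :=
  [/\ left_ideal S M, M <> S &
      forall I, left_ideal S I -> M `<=` I -> I = M \/ I = S].

Definition jacobson S : set A :=
  [set x | S x /\ forall M, maximal_left_ideal S M -> M x].

Definition set_sum I J : set A := [set a | exists2 x, I x & exists2 y, J y & a = x + y].

Definition set_prod I J : set A :=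
  [set a | exists s : seq (A * A),
     (forall p, p \in s -> I p.1 /\ J p.2) /\ a = \sum_(p <- s) p.1 * p.2].

Definition indecomposable S : Prop :=
  forall I J, twosided_ideal S I -> twosided_ideal S J ->
    set_sum I J = S -> I `&` J = [set 0] -> I = [set 0] \/ J = [set 0].

Definition corner (e : A) S : set A := [set e * x * e | x in S].

Definition left_order L : set A := [set a | forall x, L x -> L (a * x)].
Definition right_order L : set A := [set a | forall x, L x -> L (x * a)].
Definition idealizer L : set A := left_order L `&` right_order L.

(* c represents a central idempotent of S / N, where N is an ideal of S. *)
Definition central_idem_mod S N (c : A) : Prop :=
  [/\ S c, N (c * c - c) & forall x, S x -> N (c * x - x * c)].

(* c represents a central primitive idempotent of S / N. *)
Definition central_prim_idem_mod S N (c : A) : Prop :=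
  [/\ central_idem_mod S N c, ~ N c &
      forall a b, central_idem_mod S N a -> central_idem_mod S N b ->
        N (a * b) -> N (c - (a + b)) -> N a \/ N b].

(* The e i are orthogonal idempotents of S lifting the central primitive
   idempotents of S / J(S), each of which is represented exactly once:
   distinct e i are distinct modulo J(S), being orthogonal and nonzero there. *)
Definition orthogonal_lifts S (h : nat) (e : 'I_h -> A) : Prop :=
  [/\ forall i, S (e i) /\ e i * e i = e i,
      forall i j, i != j -> e i * e j = 0,
      forall i, central_prim_idem_mod S (jacobson S) (e i)
    & forall c, central_prim_idem_mod S (jacobson S) c ->
        exists i, jacobson S (c - e i)].

(* g induces, on representatives, an isomorphism M / N -> M' / N' of abelian
   groups. *)
Definition induces_quot_iso M N M' N' (g : A -> A) : Prop :=
  [/\ forall x, M x -> M' (g x),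
      forall x y, M x -> M y -> N' (g (x + y) - (g x + g y)),
      forall x, M x -> (N' (g x) <-> N x)
    & forall y, M' y -> exists2 x, M x & N' (y - g x)].

(* M / N and M' / N' are isomorphic S-S-bimodules. *)
Definition bimod_quot_iso S M N M' N' : Prop :=
  exists g : A -> A,
    [/\ induces_quot_iso M N M' N' g,
        forall s x, S s -> M x -> N' (g (s * x) - s * g x)
      & forall s x, S s -> M x -> N' (g (x * s) - g x * s)].

End Ideals.

Definition projective_module (T : nzRingType) (P : lmodType T) : Prop :=
  forall (M N : lmodType T) (p : {linear M -> N}) (g : {linear P -> N}),
    (forall y, exists x, p x = y) ->
    exists h : {linear P -> M}, forall x, p (h x) = g x.

(* The left ideals of T are the submodules of T^o, given here by their
   inclusion maps. *)
Definition left_hereditary (T : nzRingType) : Prop :=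
  forall (I : lmodType T) (i : {linear I -> T^o}),
    injective i -> projective_module I.

(* S is a subring of A which is hereditary as a ring. *)
Definition hereditary (A : nzRingType) (S : set A) : Prop :=
  exists (T : nzRingType) (i : {rmorphism T -> A}),
    [/\ injective i, range i = S & left_hereditary T].

Section Algebras.
Variables (K : fieldType) (A : falgType K).
Implicit Types (R : set K) (S M N L : set A).

(* A is semisimple as a left module over itself. *)
Definition semisimple_algebra : Prop :=
  forall I : {vspace A}, (fullv * I <= I)%VS ->
    exists J : {vspace A},
      [/\ (fullv * J <= J)%VS, (I + J)%VS = fullv & (I :&: J)%VS = 0%VS].

(* A is semisimple and the center of each simple component A c (c a central
   primitive idempotent) is a separable extension of K. For x in Z(A), the value
   of p at the element x c of the ring A c is p(x) c. *)
Definition separable_algebra : Prop :=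
  semisimple_algebra /\
  forall c : A, central_prim_idem_mod setT [set 0] c ->
  forall x : A, x \in 'Z({:A})%VS ->
    exists2 p : {poly K}, separable_poly p & horner_alg x p * c = 0.

(* The maps rho j are the components of a K-algebra morphism from A to a product
   of full matrix algebras over E whose E-linear extension
   E (x)_K A -> \prod_j M_(n_j + 1)(E) is bijective. *)
Definition is_splitting (E : fieldType) (iota : {rmorphism K -> E}) (m : nat)
    (n : 'I_m -> nat) (rho : forall j, {rmorphism A -> 'M[E]_((n j).+1)}) : Prop :=
  (forall j (c : K) (a : A), rho j (c *: a) = iota c *: rho j a) /\
  forall y : (forall j, 'M[E]_((n j).+1)), exists! c : 'rV[E]_(\dim {:A}),
    forall j, y j = \sum_i c 0 i *: rho j (vbasis {:A})`_i.

(* The reduced trace of A over K: the sum of the matrix traces after a scalar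
   extension splitting A. *)
Definition is_reduced_trace (tr : A -> K) : Prop :=
  exists (E : fieldType) (iota : {rmorphism K -> E}) (m : nat) (n : 'I_m -> nat)
         (rho : forall j, {rmorphism A -> 'M[E]_((n j).+1)}),
    is_splitting iota rho /\ forall a, iota (tr a) = \sum_j \tr (rho j a).

(* L is the R-span of a finite sequence which spans A over K. *)
Definition full_lattice R L : Prop :=
  exists s : seq A, <<s>>%VS = fullv /\
    L = [set a | exists2 c : 'I_(size s) -> K,
           forall i, R (c i) & a = \sum_i c i *: s`_i].

Definition is_order R S : Prop :=
  [/\ S 1, forall x y, S x -> S y -> S (x - y),
      forall x y, S x -> S y -> S (x * y) & full_lattice R S].

(* L^# with respect to the form (a, b) |-> tr (z a b). *)
Definition dual_lattice R (tr : A -> K) (z : A) L : set A :=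
  [set a | forall l, L l -> R (tr (z * l * a))].

(* S / N and S' / N' are isomorphic R-algebras. *)
Definition alg_quot_iso R S N S' N' : Prop :=
  exists g : A -> A,
    [/\ induces_quot_iso S N S' N' g,
        forall x y, S x -> S y -> N' (g (x * y) - g x * g y),
        N' (g 1 - 1)
      & forall r x, R r -> S x -> N' (g (r *: x) - r *: g x)].

End Algebras.

(* Main.v *)
(* Write J for J(Λ) and # for the dual with respect to the symmetrizing form, so that
   duality exchanges products and colon ideals: (M N)^# = {a : N a ⊆ M^#}.

   Γ = J^#.  The ideal J^# J contains J; let c be the sum of the e_i lying in it. Since
   commutators [c, J^#] lie in Λ, one gets (1 - c) Λ c ⊆ (1 - c) Λ c J, which vanishes by
   Nakayama. Hence c is central and c = 0 or 1. If c = 1, J is invertible on the left and Λ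
   is hereditary; so c = 0 and J^# J = J = J J^#, whence Id(J) = J^#.

   (b) If J(Γ) = J then Γ^# = J(Γ), and an ideal N ⊄ J annihilating J^- J, where
   J^- = {x : J x ⊆ Γ}, would give J N ⊆ J^2 by duality, which makes N nilpotent modulo J.
   So 1 ∈ J^- J. An order whose radical is invertible on the left is hereditary: along the
   chain L + J^i of full left ideals, M with J P ⊆ M ⊆ P is projective when P is, because for
   a complement N of M modulo J P the sequence J P -> M + N -> P splits.

   (a) Put g = 1 - f, J' = J(Γ). On the g-part the form gives g (J')^# g ⊆ J'. For
   U = {x ∈ g A f : J' x ⊆ Γ} this yields (f J g U)^2 ⊆ J', hence f J g U ⊆ J and U ⊆ Γ.
   Dually f J g ⊆ J J', so f J g = 0 by Nakayama, and f is central in Λ.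

   (c) If f = 0 then (J')^# ⊆ J', and (J')^# + Λ = (J' ∩ Λ)^# = J^# = Γ; comparing the two
   gives J' = (J')^# and Γ = J' + Λ. *)

Require Import Defs.
From HB Require Import structures.
From mathcomp Require Import all_boot all_order all_algebra all_field.
From mathcomp Require Import boolp classical_sets ring.

Set Implicit Arguments.
Unset Strict Implicit.
Unset Printing Implicit Defensive.

Import Order.TTheory GRing.Theory Num.Theory.
Local Open Scope classical_set_scope.
Local Open Scope ring_scope.

(** * Discrete valuation rings *)

(** R need not be complete, so idempotents modulo a radical cannot be lifted at will, and everything
    about Λ/J(Λ) is done with representatives. The substitute for Artinian structure theory is a
    length argument: if [pi] X ⊆ B ⊆ X, then sequences in X independent over the residue field
    modulo B have at most dim A terms. This provides the minimal and maximal elements behind maximal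
    left ideals, complements modulo the radical and the nilpotency of J modulo [pi]. Simplicity of a
    block takes the form [ideal_mem_lift]: an ideal containing J that does not kill e_i modulo J
    contains e_i. The bimodule isomorphism of the first alternative enters through its consequence
    e_i Γ e_i = e_i Λ e_i + J(e_i Γ e_i). The different corners can be treated separately because Γ
    is block diagonal modulo J: e_i Γ e_j ⊆ J for i ≠ j. Projectivity of a left ideal is witnessed
    by a dual basis of right multiplications, so it becomes a computation in A; a left ideal that
    does not span A is first enlarged by a complement taken from the semisimplicity of A. *)

Record dvr_spec (K : fieldType) (R : set K) (pi : K) : Prop := DvrSpec {
  dvr1 : R 1;
  dvrB : forall x y, R x -> R y -> R (x - y);
  dvrM : forall x y, R x -> R y -> R (x * y);
  uni_neq0 : pi != 0;
  dvr_uni : R pi;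
  uniV : ~ R pi^-1;
  dvr_unit : forall c, R c -> ~ R (c / pi) -> R c^-1;
  dvr_arch : forall c, exists n, R (pi ^+ n * c);
  dvr_princ : forall P : set K, P `<=` R -> P !=set0 ->
    exists2 c0, P c0 & forall c, P c -> exists2 r, R r & c = r * c0 }.

(** After this lemma the valuation no longer occurs. [dvr_princ] is asked of arbitrary nonempty
    subsets, not of ideals: an element of least value divides all the others. In [dvr_unit], that
    [c / pi] is outside R expresses that c is not in [pi] R. *)
Lemma is_dvrP (K : fieldType) (R : set K) :
  is_dvr R -> exists pi, dvr_spec R pi.
Proof.
case=> v [vM vD vsurj ->].
have v1 : v 1 = 0.
  have := vM 1 1 (oner_neq0 _) (oner_neq0 _); rewrite mulr1 => h.
  by apply/eqP; rewrite -(inj_eq (addrI (v 1))) -h addr0.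
have vV x : x != 0 -> v x^-1 = - v x.
  move=> x0; apply/eqP; rewrite -addr_eq0 addrC -vM ?invr_eq0 // mulfV // v1 //.
have vN x : x != 0 -> v (- x) = v x.
  move=> x0; have N1 : (-1 : K) != 0 by rewrite oppr_eq0 oner_neq0.
  rewrite -mulN1r vM //.
  have : v (-1) + v (-1) = 0 by rewrite -vM // mulrNN mulr1 v1.
  rewrite -mulr2n => /eqP; rewrite mulrn_eq0 /= => /eqP ->; exact: add0r.
have [pi pi0 vpi] := vsurj 1.
have vX n : v (pi ^+ n) = n%:Z.
  elim: n => [|n IH]; first by rewrite expr0 v1.
  by rewrite exprS vM ?expf_neq0 // IH vpi -intS.
exists pi; split => //=.
- by right; rewrite v1.
- move=> x y [->|hx] [->|hy]; rewrite ?(subr0, sub0r); try by left.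
  + by have [->|y0] := eqVneq y 0; [left; rewrite oppr0|right; rewrite vN].
  + by right.
  + have [->|x0] := eqVneq x 0.
      by have [->|y0] := eqVneq y 0; [left; rewrite subr0|right; rewrite sub0r vN].
    have [->|y0] := eqVneq y 0; first by right; rewrite subr0.
    have [->|s0] := eqVneq (x - y) 0; first by left.
    right; apply: le_trans (vD _ _ x0 _ s0); last by rewrite oppr_eq0.
    by rewrite le_min hx vN.
- move=> x y [->|hx] [->|hy]; rewrite ?(mulr0, mul0r); try by left.
  have [->|x0] := eqVneq x 0; first by left; rewrite mul0r.
  have [->|y0] := eqVneq y 0; first by left; rewrite mulr0.
  by right; rewrite vM // addr_ge0.
- by right; rewrite vpi.
- by case=> [/eqP|]; rewrite ?invr_eq0 ?(negPf pi0) // vV // vpi.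
- move=> c [->|hc] H.
    by exfalso; apply: H; left; rewrite mul0r.
  have [c0|c0] := eqVneq c 0; first by exfalso; apply: H; left; rewrite c0 mul0r.
  right; rewrite vV // oppr_ge0 leNgt; apply/negP => h; apply: H; right.
  rewrite vM ?invr_eq0 // vV // vpi subr_ge0; by rewrite -gtz0_ge1.
- move=> c; have [->|c0] := eqVneq c 0; first by exists 0; left; rewrite mulr0.
  exists `|v c|%N; right; rewrite vM ?expf_neq0 // vX abszE addrC -lerBlDr sub0r.
  by rewrite lerNl; apply: le_trans (ler_norm _) _; rewrite normrN.
- move=> P PR [c1 Pc1].
  have [c1e|c10] := pselect (forall c, P c -> c = 0).
    exists c1 => // c Pc; exists 0; first by left.
    by rewrite mul0r (c1e c).
  have [c2 [Pc2 c20]] : exists c, P c /\ c != 0.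
    apply: contrapT => H; apply: c10 => c Pc; apply/eqP; apply/negP => /negP c0.
    by apply: H; exists c.
  pose Q n := `[< exists c, [/\ P c, c != 0 & `|v c|%N = n] >].
  have Qex : exists n, Q n by exists `|v c2|%N; apply/asboolP; exists c2.
  case: (ex_minnP Qex) => m /asboolP [c3 [Pc3 c30 vc3]] mmin.
  have pos c : P c -> c != 0 -> 0 <= v c.
    by move=> Pc c0; case: (PR _ Pc) => [e|//]; rewrite e eqxx in c0.
  exists c3 => // c Pc; have [->|c0] := eqVneq c 0.
    by exists 0; [left|rewrite mul0r].
  exists (c / c3); last by rewrite divfK.
  right; rewrite vM ?invr_eq0 // vV // subr_ge0.
  have : (m <= `|v c|)%N by apply: mmin; apply/asboolP; exists c.
  by rewrite -vc3 -lez_nat !gez0_abs ?pos.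
Qed.

Section Dvr.
Variables (K : fieldType) (R : set K) (pi : K) (HR : dvr_spec R pi).

Lemma dvr0 : R 0. Proof. by rewrite -(subrr 1); apply: (dvrB HR); exact: (dvr1 HR). Qed.
Lemma dvrN x : R x -> R (- x).
Proof. by rewrite -sub0r => h; apply: (dvrB HR) => //; exact: dvr0. Qed.
Lemma dvrD x y : R x -> R y -> R (x + y).
Proof. by move=> hx hy; rewrite -[y]opprK; apply: (dvrB HR) => //; apply: dvrN. Qed.
Lemma dvr_uniX n : R (pi ^+ n).
Proof.
elim: n => [|n IH]; first by rewrite expr0; exact: (dvr1 HR).
by rewrite exprS; apply: (dvrM HR) => //; exact: (dvr_uni HR).
Qed.
Lemma uniX_neq0 n : pi ^+ n != 0. Proof. by rewrite expf_neq0 ?(uni_neq0 HR). Qed.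

(** An entry of least value serves as [i0]. Dividing a relation over K by it gives a relation over R
    with one coefficient equal to 1, hence nontrivial over the residue field. *)
Lemma dvr_total (I : finType) (c : I -> K) : (exists i, c i != 0) ->
  exists i0, c i0 != 0 /\ forall i, R (c i / c i0).
Proof.
move=> [i1 ci1].
have [n Hn] : exists n, forall i, R (pi ^+ n * c i).
  have [m Hm] := choice (fun i => dvr_arch HR (c i)).
  exists (\sum_i m i)%N => i; rewrite (bigD1 i) //= exprD mulrAC.
  by apply: (dvrM HR) => //; exact: dvr_uniX.
pose P : set K := [set x | exists i, x = pi ^+ n * c i].
have [||x [i ->] H] := @dvr_princ _ _ _ HR P.
- by move=> x [i ->].
- by exists (pi ^+ n * c i1); exists i1.
have ci : c i != 0.
  apply/eqP => ci0; have [|r _] := H (pi ^+ n * c i1); first by exists i1.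
  by rewrite ci0 !mulr0 => /eqP; rewrite mulf_eq0 (negPf ci1) (negPf (uniX_neq0 _)).
exists i; split=> // j; have [|r Rr e] := H (pi ^+ n * c j); first by exists j.
have {e} -> : c j = r * c i.
  by apply: (mulfI (uniX_neq0 n)); rewrite e mulrCA.
by rewrite mulfK.
Qed.

Lemma dvr_arch0 (c : K) N : (forall n, R (pi ^+ N * (pi ^- n * c))) -> c = 0.
Proof.
move=> H; apply/eqP; apply/negP => /negP c0; apply: (uniV HR).
have [n Hn] := dvr_arch HR c^-1.
(* The exponent n + N + 1 is chosen so that the product is exactly [pi^-1]. *)
have := dvrM HR (H (n + N).+1) Hn.
have p0 := uni_neq0 HR; have a0 := uniX_neq0 n; have b0 := uniX_neq0 N.
rewrite exprS exprD.
suff -> : pi ^+ N * ((pi * (pi ^+ n * pi ^+ N))^-1 * c) * (pi ^+ n * c^-1) = pi^-1 by [].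
by field; rewrite p0 a0 b0 c0.
Qed.

End Dvr.

(** * Lattices over a discrete valuation ring *)

Section Modules.
Variables (K : fieldType) (R : set K) (pi : K) (HR : dvr_spec R pi).
Variable A : falgType K.
Implicit Types (L M N B X Y : set A) (s : seq A).

Definition submodule L : Prop :=
  [/\ L 0, forall x y, L x -> L y -> L (x - y) & forall r x, R r -> L x -> L (r *: x)].

Section SubmoduleTheory.
Variables (L : set A) (HL : submodule L).
Lemma submod0 : L 0. Proof. by case: HL. Qed.
Lemma submodB x y : L x -> L y -> L (x - y). Proof. by case: HL => _ + _; apply. Qed.
Lemma submodZ r x : R r -> L x -> L (r *: x). Proof. by case: HL => _ _; apply. Qed.
Lemma submodN x : L x -> L (- x).
Proof. by move=> Lx; rewrite -sub0r; apply: submodB => //; exact: submod0. Qed.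
Lemma submodD x y : L x -> L y -> L (x + y).
Proof. by move=> Lx Ly; rewrite -[y]opprK; apply: submodB => //; apply: submodN. Qed.
Lemma submod_sum (I : Type) (r : seq I) (P : pred I) (F : I -> A) :
  (forall i, P i -> L (F i)) -> L (\sum_(i <- r | P i) F i).
Proof. by move=> H; elim/big_ind: _ => //; [exact: submod0|exact: submodD]. Qed.
End SubmoduleTheory.

(** Recursive on the generators, with the coefficient of the head split off, so that submodules can
    be treated by induction on [s]; [rspanP] compares it with the sums in [full_lattice]. *)
Fixpoint rspan s : set A :=
  if s is x :: s' then [set a | exists2 c, R c & rspan s' (a - c *: x)] else [set 0].

Lemma rspan_submodule s : submodule (rspan s).
Proof.
elim: s => [|x s IH] /=; first by split=> //= [a b -> ->|r a _ ->]; rewrite ?subr0 ?scaler0.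
split.
- by exists 0; [exact: (dvr0 HR)|rewrite scale0r subr0; exact: submod0].
- move=> a b [c Rc Ha] [d Rd Hb]; exists (c - d); first exact: (dvrB HR).
  have -> : a - b - (c - d) *: x = (a - c *: x) - (b - d *: x).
    by rewrite scalerBl !opprB [d *: x - b]addrC [RHS]addrACA [- (c *: x) + _]addrC.
  exact: submodB.
- move=> r a Rr [c Rc Ha]; exists (r * c); first exact: (dvrM HR).
  by rewrite -scalerA -scalerBr; apply: submodZ.
Qed.

Lemma rspan_cons x s a : rspan s a -> rspan (x :: s) a.
Proof.
by move=> sa; exists 0; [exact: (dvr0 HR)|rewrite scale0r subr0].
Qed.

Lemma rspan_mem s x : x \in s -> rspan s x.
Proof.
elim: s => // y s IH; rewrite inE => /orP[/eqP->|/IH]; last exact: rspan_cons.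
exists 1; first exact: (dvr1 HR).
by rewrite scale1r subrr; exact: submod0 (rspan_submodule _).
Qed.

Lemma rspan_min s L : submodule L -> {in s, forall x, L x} -> rspan s `<=` L.
Proof.
move=> HL; elim: s => [|x s IH] H a /=; first by move=> ->; exact: submod0.
case=> c Rc Ha; rewrite -(subrK (c *: x) a); apply: (submodD HL).
  by apply: IH Ha => y ys; apply: H; rewrite inE ys orbT.
by apply: (submodZ HL) => //; apply: H; rewrite mem_head.
Qed.

Lemma rspanP s a : rspan s a <->
  exists2 c : 'I_(size s) -> K, forall i, R (c i) & a = \sum_i c i *: s`_i.
Proof.
split; last first.
  move=> [c Rc ->]; apply: (submod_sum (rspan_submodule _)) => i _.
  by apply: (submodZ (rspan_submodule _)) => //; apply: rspan_mem; exact: mem_nth.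
elim: s a => [|x s IH] a /=.
  by move=> ->; exists (fun=> 0); [move=> i; exact: (dvr0 HR)|rewrite big_ord0].
case=> c Rc /IH [d Rd e].
exists (fun i => if unlift ord0 i is Some j then d j else c).
  by move=> i; case: unliftP.
rewrite big_ord_recl unlift_none /= -[LHS](subrK (c *: x)) addrC e; congr (_ + _).
by apply: eq_bigr => i _; rewrite liftK.
Qed.

(** The coefficients at the head [x] of elements of [N] are all multiples of one of them, attained
    at [y0]; subtracting a multiple of [y0] leaves an element of [N] in the span of the tail. *)
Lemma fg_submodule s N : submodule N -> N `<=` rspan s ->
  exists s', N = rspan s'.
Proof.
elim: s N => [|x s IH] N HN Ns.
  exists [::]; apply/seteqP; split=> // a /= ->; exact: submod0.
have [s' Hs'] : exists s', N `&` rspan s = rspan s'.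
  apply: IH; last by move=> ? [].
  have Hs := rspan_submodule s; split.
  - by split; exact: submod0.
  - by move=> a b [? ?] [? ?]; split; apply: submodB.
  - by move=> r a ? [? ?]; split; apply: submodZ.
pose P : set K := [set c | R c /\ exists2 a, N a & rspan s (a - c *: x)].
have [||c0 [Rc0 [y0 Ny0 sy0]] Pc0] := @dvr_princ _ _ _ HR P.
- by move=> c [].
- exists 0; split; first exact: (dvr0 HR).
  exists 0; rewrite ?scale0r ?subr0; [exact: submod0|exact: submod0 (rspan_submodule _)].
exists (y0 :: s'); apply/seteqP; split; last first.
  apply: rspan_min => // y; rewrite inE => /orP[/eqP->//|/rspan_mem].
  by rewrite -Hs' => -[].
move=> a Na; have [c Rc sa] := Ns _ Na.
have [r Rr e] := Pc0 c (conj Rc (ex_intro2 _ _ a Na sa)).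
exists r => //; rewrite -Hs'; split; first by apply: (submodB HN) => //; apply: (submodZ HN).
have -> : a - r *: y0 = (a - c *: x) - r *: (y0 - c0 *: x).
  by rewrite scalerBr scalerA -e opprB addrA subrK.
by have Hs := rspan_submodule s; apply: submodB => //; apply: submodZ.
Qed.

Lemma rspan_full s x : x \in <<s>>%VS -> exists n, rspan s (pi ^+ n *: x).
Proof.
move=> xs; pose c := coord (in_tuple s) ^~ x.
have [n Hn] := choice (fun i => dvr_arch HR (c i)).
exists (\sum_i n i)%N; rewrite (coord_span (X := in_tuple s) xs) scaler_sumr.
apply: (submod_sum (rspan_submodule s)) => i _; rewrite scalerA.
apply: (submodZ (rspan_submodule s)); last by apply: rspan_mem; exact: mem_nth.
rewrite (bigD1 i) //= addnC exprD -mulrA; apply: (dvrM HR) => //; exact: (dvr_uniX HR).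
Qed.

Definition lattice L : Prop := submodule L /\ exists s, L `<=` rspan s.

Lemma lattice_fg L : lattice L -> exists s, L = rspan s.
Proof. by case=> HL [s]; exact: fg_submodule. Qed.

Lemma lattice_sub L M : lattice L -> submodule M -> M `<=` L -> lattice M.
Proof. by case=> _ [s Ls] HM ML; split=> //; exists s => x /ML/Ls. Qed.

(** Nakayama by elimination: the head [x] occurs in its own equation with a coefficient [pi * c], so
    [1 - pi * c] is a unit, the equation can be solved for [x], and the result substituted into the
    other equations. *)
Lemma nakayama_rspan s N : submodule N ->
  {in s, forall x, exists y n, [/\ rspan s y, N n & x = n + pi *: y]} ->
  rspan s `<=` N.
Proof.
move=> HN; elim: s => [|x s IH] H; first by move=> a /= ->; exact: submod0.
have Hs := rspan_submodule s.
have [y [n [[c Rc sy] Nn ex]]] := H x (mem_head _ _).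
pose u := 1 - pi * c.
have Ru : R u by apply: (dvrB HR); [exact: (dvr1 HR)|apply: (dvrM HR) => //; exact: (dvr_uni HR)].
have Ru1 : ~ R (u / pi).
  move=> h; apply: (uniV HR).
  have := dvrD HR h Rc; congr (R _); rewrite /u mulrBl mul1r mulrAC mulfV ?(uni_neq0 HR) //.
  by rewrite mul1r subrK.
have u0 : u != 0 by apply/eqP => e; apply: Ru1; rewrite e mul0r; exact: (dvr0 HR).
have RuV := dvr_unit HR Ru Ru1.
have ex' : x = u^-1 *: n + pi *: (u^-1 *: (y - c *: x)).
  apply: (scalerI u0); rewrite scalerDr scalerA mulfV // scale1r.
  rewrite !scalerA mulrAC mulfV // mul1r scalerBr addrA -ex.
  by rewrite scalerA /u scalerBl scale1r.
move: (u^-1 *: n) (submodZ HN RuV Nn) (u^-1 *: (y - c *: x)) (submodZ Hs RuV sy) ex' => n1 Nn1 y1 sy1 e1.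
have sN : rspan s `<=` N.
  apply: IH => x2 x2s; have [|y2 [n2 [[c2 Rc2 sy2] Nn2 ->]]] := H x2.
    by rewrite inE x2s orbT.
  have piR := dvr_uni HR.
  exists ((y2 - c2 *: x) + (c2 * pi) *: y1), (n2 + (pi * c2) *: n1); split.
  - by apply: (submodD Hs) => //; apply: (submodZ Hs) => //; apply: (dvrM HR).
  - by apply: (submodD HN) => //; apply: (submodZ HN) => //; apply: (dvrM HR).
  - rewrite -addrA; congr (_ + _); rewrite [in RHS]scalerDr scalerA mulrA addrCA.
    by rewrite -[(_ * pi) *: y1]scalerA -scalerDr -e1 -scalerA -scalerDr subrK.
have Nx : N x by rewrite e1; apply: (submodD HN) => //; apply: (submodZ HN); [exact: (dvr_uni HR)|exact: sN].
by apply: rspan_min => // z; rewrite inE => /orP[/eqP->//|/rspan_mem/sN].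
Qed.

Lemma nakayama_lattice L N : lattice L -> submodule N ->
  (forall x, L x -> exists y n, [/\ L y, N n & x = n + pi *: y]) -> L `<=` N.
Proof.
move=> /lattice_fg[s ->] HN H; apply: nakayama_rspan => // x xs.
by apply: H; exact: rspan_mem.
Qed.

(* Linear independence over the residue field modulo B; sizes of such sequences
   measure the length of X / B when pi X <= B. *)
Definition res_free B s : Prop := forall c : nat -> K, (forall i, R (c i)) ->
  B (\sum_(0 <= i < size s) c i *: s`_i) -> forall i, (i < size s)%N -> R (c i / pi).

Lemma res_free_size B s : submodule B -> res_free B s -> (size s <= \dim {:A})%N.
Proof.
move=> HB Hs; have fs : free (in_tuple s).
  apply/freeP => k Hk i; apply/eqP; apply/negP => /negP ki.
  have [i0 [ki0 Hi0]] := dvr_total HR (ex_intro _ i ki).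
  apply: (uniV HR).
  pose c n := if insub n is Some j then k j / k i0 else 0.
  have cE (j : 'I_(size s)) : c j = k j / k i0 by rewrite /c valK.
  have := Hs c _ _ i0 (ltn_ord i0); rewrite cE divff // mul1r; apply.
    by move=> n; rewrite /c; case: insubP => // _; exact: (dvr0 HR).
  rewrite big_mkord (eq_bigr (fun j => (k i0)^-1 *: (k j *: s`_j))).
    by rewrite -scaler_sumr Hk scaler0; exact: submod0.
  by move=> j _; rewrite cE scalerA mulrC.
by move: fs; rewrite /free /= => /eqP <-; exact: dimvS (subvf _).
Qed.

Definition between B X : Prop :=
  [/\ submodule X, B `<=` X & forall x, X x -> B (pi *: x)].

Definition res_rank_ge B X n : Prop :=
  exists s, [/\ size s = n, {in s, forall x, X x} & res_free B s].

(** Some [y] in [Y] outside [X] is put in front of the sequence. A unit coefficient at [y] would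
    express [y] through [X]; hence this coefficient is in [pi] R, its term is in [B], and the rest
    is a relation of the old sequence. *)
Lemma res_rank_ltS B X Y n : submodule B -> between B X -> between B Y ->
  X `<=` Y -> ~ Y `<=` X -> res_rank_ge B X n -> res_rank_ge B Y n.+1.
Proof.
move=> HB [HX BX piX] [HY BY piY] XY /existsNP[y /not_implyP[Yy Xy]] [s [sn sX Hs]].
exists (y :: s); split; first by rewrite /= sn.
  by move=> z; rewrite inE => /orP[/eqP->//|/sX/XY].
move=> c Rc; rewrite /= big_nat_recl //= => Bc.
have c0 : R (c 0 / pi).
  apply: contrapT => h; apply: Xy.
  have c00 : c 0 != 0 by apply/eqP => e; apply: h; rewrite e mul0r; exact: (dvr0 HR).
  rewrite -[y](scalerK c00); apply: (submodZ HX); first exact: (dvr_unit HR).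
  rewrite -[X in X (_ *: _)]/(X) -(addrK (\sum_(0 <= i < size s) c i.+1 *: s`_i) (c 0 *: y)).
  apply: (submodB HX); first exact: BX.
  rewrite big_mkord; apply: (submod_sum HX) => i _; apply: (submodZ HX) => //; apply: sX; exact: mem_nth.
case=> [|i] //; rewrite ltnS; apply: (Hs (fun i => c i.+1)) => //.
rewrite -(addKr (c 0 *: y) (\sum_(0 <= i < size s) _)); apply: (submodD HB) => //.
apply: (submodN HB); rewrite -[c 0](divfK (uni_neq0 HR)) -scalerA; apply: (submodZ HB) => //.
exact: piY.
Qed.

(** With [between_min], the ascending and descending chain conditions for the modules between [B]
    and their ambient lattice; all later choices of maximal or minimal submodules come from these
    two lemmas. *)
Lemma between_max B (P : set (set A)) : submodule B ->
  (forall X, P X -> between B X) -> P !=set0 ->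
  exists2 X, P X & forall Y, P Y -> X `<=` Y -> Y = X.
Proof.
move=> HB PB [X0 PX0].
pose Q n := `[< exists2 X, P X & res_rank_ge B X n >].
have Qex : exists n, Q n.
  exists 0%N; apply/asboolP; exists X0 => //; exists [::]; split=> //.
have Qle n : Q n -> (n <= \dim {:A})%N.
  by move=> /asboolP[X PX [s [<- _ Hs]]]; apply: res_free_size Hs.
case: (ex_maxnP Qex Qle) => m /asboolP[X PX Xm] mmax; exists X => // Y PY XY.
apply/seteqP; split=> //; apply: contrapT => YX.
suff : (m.+1 <= m)%N by rewrite ltnn.
by apply: mmax; apply/asboolP; exists Y => //; apply: res_rank_ltS YX Xm => //; exact: PB.
Qed.

Lemma between_min B (P : set (set A)) : submodule B ->
  (forall X, P X -> between B X) -> P !=set0 ->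
  exists2 X, P X & forall Y, P Y -> Y `<=` X -> Y = X.
Proof.
move=> HB PB [X0 PX0].
(* The least such [n] is one more than the smallest rank attained; it exists because no sequence has
   dim A + 1 terms, and it is not 0 because the empty sequence is always independent. *)
pose Q n := `[< exists2 X, P X & ~ res_rank_ge B X n >].
have Qex : exists n, Q n.
  exists (\dim {:A}).+1; apply/asboolP; exists X0 => // -[s [sn _ Hs]].
  by have := res_free_size HB Hs; rewrite sn ltnn.
case: (ex_minnP Qex) => m /asboolP[X PX Xm] mmin; exists X => // Y PY YX.
apply/seteqP; split=> //; apply: contrapT => XY.
case: m => [|m] in Xm mmin *; first by apply: Xm; exists [::]; split.
suff : (m.+1 <= m)%N by rewrite ltnn.
apply: mmin; apply/asboolP; exists Y => // Ym; apply: Xm.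
by apply: res_rank_ltS XY Ym => //; exact: PB.
Qed.

(** A generating sequence of least length is free over K: in a relation scaled to have one
    coefficient 1, that generator could be dropped. So [L] has a basis whose coordinates are
    integral exactly on [L], and one of them is not integral at [x]. *)
Lemma lattice_sep L : lattice L -> (forall x, exists n, L (pi ^+ n *: x)) ->
  forall x, ~ L x -> exists psi : {scalar A},
    (forall y, L y -> R (psi y)) /\ ~ R (psi x).
Proof.
move=> /lattice_fg[s0 L0] Lfull x Lx.
pose Q n := `[< exists s, L = rspan s /\ size s = n >].
have Qex : exists n, Q n by exists (size s0); apply/asboolP; exists s0.
case: (ex_minnP Qex) => m /asboolP[s [Ls sm]] mmin.
have fs : free (in_tuple s).
  apply/freeP => k Hk i; apply/eqP; apply/negP => /negP ki.
  have [i0 [ki0 Hi0]] := dvr_total HR (ex_intro _ i ki).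
  suff : (m <= (size s).-1)%N by rewrite -sm -[X in (X <= _)%N -> _](ltn_predK (ltn_ord i0)) ltnn.
  apply: mmin; apply/asboolP.
  pose s' := [seq s`_(nat_of_ord j) | j <- enum (predC1 i0)].
  exists s'; split; last first.
    by rewrite size_map -cardE cardC1 card_ord.
  have s's : {in s', forall y, rspan s y}.
    by move=> y /mapP[j _ ->]; apply: rspan_mem; exact: mem_nth.
  apply/seteqP; rewrite Ls; split; last by apply: rspan_min => //; exact: rspan_submodule.
  apply: rspan_min; first exact: rspan_submodule.
  have Hj (j : 'I_(size s)) : j != i0 -> rspan s' s`_j.
    by move=> ji; apply: rspan_mem; apply/mapP; exists j; rewrite // mem_enum inE.
  move=> y /(nthP 0)[n ns <-]; have [e|/Hj//] := eqVneq (Ordinal ns) i0.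
  have -> : s`_n = - \sum_(j | j != i0) (k j / k i0) *: s`_j.
    apply: (scalerI ki0); rewrite scalerN scaler_sumr.
    move: Hk; rewrite (bigD1 i0) //= => /eqP; rewrite addr_eq0 => /eqP.
    rewrite -e /= => ->; congr (- _); apply: eq_bigr => j _.
    by rewrite scalerA mulrCA mulfV ?mulr1 // e.
  have Hs' := rspan_submodule s'.
  by apply: (submodN Hs'); apply: (submod_sum Hs') => j ji; apply: (submodZ Hs') => //; exact: Hj.
have sx : x \in <<in_tuple s>>%VS.
  have [n] := Lfull x; rewrite Ls => /rspanP[c _ e].
  rewrite -[x](scalerK (uniX_neq0 HR n)) e memvZ // memv_suml // => i _.
  by rewrite memvZ // memv_span // mem_nth.
have [i Hi] : exists i, ~ R (coord (in_tuple s) i x).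
  apply/existsNP => H; apply: Lx; rewrite Ls; apply/rspanP.
  by exists (fun i => coord (in_tuple s) i x); last exact: coord_span.
exists (coord (in_tuple s) i); split=> // y; rewrite Ls => /rspanP[c Rc ->].
by have /= -> := coord_sum_free c i fs.
Qed.

(** Each coordinate functional of A takes values of bounded denominator on a lattice, so it vanishes
    on an element divisible by all powers of [pi]. *)
Lemma lattice_capX L x : lattice L -> (forall n, exists2 y, L y & x = pi ^+ n *: y) -> x = 0.
Proof.
move=> /lattice_fg[s ->] H; rewrite (coord_vbasis (memvf x)); apply: big1 => i _.
pose c : {scalar A} := coord (vbasis fullv) i; rewrite -/(c x).
have [m Hm] : exists m, forall y, rspan s y -> R (pi ^+ m * c y).
  elim: s {H} => [|z s [m IH]].
    by exists 0%N => y /= ->; rewrite linear0 mulr0; exact: (dvr0 HR).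
  have [n Hn] := dvr_arch HR (c z); exists (m + n)%N => y [d Rd /IH Hy].
  have -> : c y = c (y - d *: z) + d * c z by rewrite linearB linearZ /= subrK.
  rewrite mulrDr exprD; apply: (dvrD HR).
    by rewrite mulrAC; apply: (dvrM HR) => //; exact: dvr_uniX.
  rewrite -mulrA; apply: (dvrM HR); first exact: dvr_uniX.
  by rewrite mulrCA; apply: (dvrM HR).
rewrite (@dvr_arch0 _ _ _ HR (c x) m) ?scale0r // => n.
have [y sy ->] := H n; rewrite linearZ /= mulKf; last exact: uniX_neq0 HR _.
exact: Hm.
Qed.

End Modules.

(** * The Jacobson radical of an order *)

Section SetProd.
Variable A : nzRingType.
Implicit Types I J X : set A.

(** The induction principle for [set_prod]: below, [X] is usually the set of elements having the
    property to be proved. *)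
Lemma set_prod_min I J X : X 0 -> (forall x y, X x -> X y -> X (x + y)) ->
  (forall x y, I x -> J y -> X (x * y)) -> set_prod I J `<=` X.
Proof.
move=> X0 XD XM _ [s [+ ->]]; elim: s => [|p s IH] H; first by rewrite big_nil.
rewrite big_cons; apply: XD.
  by have [] := H p (mem_head _ _); exact: XM.
by apply: IH => q qs; apply: H; rewrite inE qs orbT.
Qed.

Lemma set_prod_mem I J x y : I x -> J y -> set_prod I J (x * y).
Proof.
by move=> Ix Jy; exists [:: (x, y)]; rewrite big_seq1; split=> // p; rewrite inE => /eqP ->.
Qed.

Lemma set_prod0 I J : set_prod I J 0.
Proof. by exists [::]; rewrite big_nil. Qed.

Lemma set_prodD I J x y : set_prod I J x -> set_prod I J y -> set_prod I J (x + y).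
Proof.
move=> [s [Hs ->]] [t [Ht ->]]; exists (s ++ t); rewrite big_cat; split=> // p.
by rewrite mem_cat => /orP[/Hs|/Ht].
Qed.

Lemma set_prod_mulr I J J' a : (forall y, J y -> J' (y * a)) ->
  forall x, set_prod I J x -> set_prod I J' (x * a).
Proof.
move=> H; apply: set_prod_min => [|x y|x y Ix Jy]; first by rewrite mul0r; exact: set_prod0.
  by rewrite mulrDl; exact: set_prodD.
by rewrite -mulrA; apply: set_prod_mem => //; exact: H.
Qed.

Lemma set_prod_mull I I' J a : (forall y, I y -> I' (a * y)) ->
  forall x, set_prod I J x -> set_prod I' J (a * x).
Proof.
move=> H; apply: set_prod_min => [|x y|x y Ix Jy]; first by rewrite mulr0; exact: set_prod0.
  by rewrite mulrDr; exact: set_prodD.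
by rewrite mulrA; apply: set_prod_mem => //; exact: H.
Qed.

End SetProd.

Section Orders.
Variables (K : fieldType) (R : set K) (pi : K) (HR : dvr_spec R pi).
Variable A : falgType K.
Implicit Types (I M N X : set A).

Let submod0 L := @submod0 K R A L.
Let submodB L := @submodB K R A L.
Let submodD L := @submodD K R A L.
Let submodZ L := @submodZ K R A L.

(** The unit [u] is a parameter so that corners e S e, with unit e, are covered by the same theory
    of the radical. *)
Record order_with (u : A) (S : set A) : Prop := OrderWith {
  ord_lattice : lattice R S;
  ordM : forall x y, S x -> S y -> S (x * y);
  ord_one : S u;
  ord_mul1 : forall x, S x -> u * x = x;
  ord_1mul : forall x, S x -> x * u = x }.

Lemma set_prod_submodule (I J : set A) : submodule R I -> submodule R (set_prod I J).
Proof.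
move=> HI; have Z r x : R r -> set_prod I J x -> set_prod I J (r *: x).
  move=> Rr; move: x; apply: set_prod_min => [|x y|x y Ix Jy].
  - by rewrite scaler0; exact: set_prod0.
  - by rewrite scalerDr; exact: set_prodD.
  - by rewrite scalerAl; apply: set_prod_mem => //; apply: submodZ HI _ _ _ _.
split=> // [|x y Hx Hy]; first exact: set_prod0.
apply: set_prodD => //; rewrite -scaleN1r; apply: Z => //.
by apply: (dvrN HR); exact: (dvr1 HR).
Qed.

Section OneOrder.
Variables (u : A) (S : set A) (HS : order_with u S).
Notation J := (jacobson S).

Let Ssm : submodule R S. Proof. by case: (ord_lattice HS). Qed.
Let SM := ordM HS.
Let Su := ord_one HS.
Let uS := ord_mul1 HS.
Let Su1 := ord_1mul HS.

Lemma left_ideal_submodule I : left_ideal S I -> submodule R I.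
Proof.
move=> [IS [I0 IB] IM]; split=> // r x Rr Ix.
rewrite -(uS (IS _ Ix)) scalerAl; apply: IM => //; exact: (submodZ Ssm).
Qed.

Lemma left_ideal_unit I : left_ideal S I -> I u -> I = S.
Proof.
move=> [IS _ IM] Iu; apply/seteqP; split=> // x Sx.
by rewrite -(Su1 Sx); exact: IM.
Qed.

Lemma left_ideal_nakayama I : left_ideal S I ->
  (exists y n, [/\ S y, I n & u = n + pi *: y]) -> I u.
Proof.
move=> HI [y [n [Sy In e]]]; have Ism := left_ideal_submodule HI.
apply: (nakayama_lattice HR (ord_lattice HS) Ism) => // x Sx.
exists (x * y), (x * n); split; [exact: SM|by case: HI => _ _; apply|].
by rewrite -[in LHS](Su1 Sx) e mulrDr -scalerAr.
Qed.

(** Adding [pi] S to a proper left ideal keeps it proper by Nakayama, and above [pi] S a maximal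
    choice exists by finite length. *)
Lemma maximal_left_ideal_exists I : left_ideal S I -> ~ I u ->
  exists2 M, maximal_left_ideal S M & I `<=` M.
Proof.
move=> HI Iu; have piR := dvr_uni HR.
pose B : set A := [set x | exists2 y, S y & x = pi *: y].
have HB : submodule R B.
  split; first by exists 0; [exact: (submod0 Ssm)|rewrite scaler0].
    by move=> _ _ [x Sx ->] [y Sy ->]; exists (x - y); [exact: (submodB Ssm)|rewrite scalerBr].
  by move=> r _ Rr [x Sx ->]; exists (r *: x); [exact: (submodZ Ssm)|rewrite scalerA mulrC -scalerA].
pose P X := [/\ left_ideal S X, I `<=` X, B `<=` X & ~ X u].
have [||M [HM IM BM Mu] Mmax] := @between_max _ _ _ HR _ B P HB.
- move=> X [HX IX BX _]; split=> //; first exact: left_ideal_submodule.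
  by move=> x Xx; exists x => //; case: HX => + _ _; apply.
- exists [set x | exists2 n, I n & exists2 b, B b & x = n + b].
  have [IS [I0 IB] IM] := HI; split.
  + split.
    * move=> _ [n In [_ [y Sy ->] ->]]; apply: (submodD Ssm); first exact: IS.
      exact: (submodZ Ssm).
    * split; first by exists 0 => //; exists 0; rewrite ?addr0 //; exact: (submod0 HB).
      move=> _ _ [n In [b Bb ->]] [m Im [c Bc ->]]; exists (n - m); first exact: IB.
      by exists (b - c); [exact: (submodB HB)|rewrite opprD addrACA].
    * move=> s _ Ss [n In [_ [y Sy ->] ->]]; exists (s * n); first exact: IM.
      exists (pi *: (s * y)); last by rewrite mulrDr -scalerAr.
      by exists (s * y) => //; exact: SM.
  + by move=> x Ix; exists x => //; exists 0; rewrite ?addr0 //; exact: (submod0 HB).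
  + by move=> x Bx; exists 0 => //; exists x; rewrite ?add0r.
  + move=> [n In [_ [y Sy ->] e]]; apply: Iu; apply: left_ideal_nakayama => //.
    by exists y, n.
- exists M => //; split=> //; first by move=> e; apply: Mu; rewrite e.
  move=> Y HY MY; have [Yu|Yu] := pselect (Y u).
    by right; exact: left_ideal_unit.
  by left; apply: Mmax => //; split=> // x; [move/IM/MY|move/BM/MY].
Qed.

Lemma jac_sub : J `<=` S. Proof. by move=> x []. Qed.

(** Left quasi-regularity, unlike the definition by maximal left ideals, can be transported to
    corners and from Λ to Γ. *)
Lemma jacP x : J x <-> S x /\ forall s, S s -> exists2 t, S t & t * (u - s * x) = u.
Proof.
split.
  move=> [Sx Jx]; split=> // s Ss; apply: contrapT => H.
  have Sux : S (u - s * x) by apply: (submodB Ssm) => //; exact: SM.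
  pose I : set A := [set y | exists2 t, S t & y = t * (u - s * x)].
  have HI : left_ideal S I.
    split; first by move=> _ [t St ->]; exact: SM.
    - split; first by exists 0; rewrite ?mul0r //; exact: (submod0 Ssm).
      by move=> _ _ [t St ->] [t' St' ->]; exists (t - t'); rewrite ?mulrBl //; exact: (submodB Ssm).
    - by move=> r _ Sr [t St ->]; exists (r * t); rewrite ?mulrA //; exact: SM.
  have [|M HM IM] := maximal_left_ideal_exists HI; first by move=> [t St e]; apply: H; exists t.
  have Msm : submodule R M by case: HM => /left_ideal_submodule.
  have [LM MS _] := HM; apply: MS; apply: left_ideal_unit => //.
  rewrite -(subrK (s * x) u); apply: (submodD Msm).
    by apply: IM; exists u => //; rewrite uS.
  by case: LM => _ _; apply=> //; exact: Jx.
move=> [Sx H]; split=> // M HM; apply: contrapT => Mx.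
have [LM MS Mmax] := HM; have Msm := left_ideal_submodule LM.
have [MS' _ MM] := LM.
pose I : set A := [set y | exists2 m, M m & exists2 s, S s & y = m + s * x].
have HI : left_ideal S I.
  split.
  - by move=> _ [m Mm [s Ss ->]]; apply: (submodD Ssm); [exact: MS'|exact: SM].
  - split; first by exists 0; [exact: (submod0 Msm)|exists 0; rewrite ?mul0r ?addr0 //; exact: (submod0 Ssm)].
    move=> _ _ [m Mm [s Ss ->]] [n Mn [t St ->]]; exists (m - n); first exact: (submodB Msm).
    by exists (s - t); [exact: (submodB Ssm)|rewrite mulrBl opprD addrACA].
  - move=> r _ Sr [m Mm [s Ss ->]]; exists (r * m); first exact: MM.
    by exists (r * s); [exact: SM|rewrite mulrDr mulrA].
have [|e|e] := Mmax I HI.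
- by move=> m Mm; exists m => //; exists 0; rewrite ?mul0r ?addr0 //; exact: (submod0 Ssm).
- apply: Mx; rewrite -e; exists 0; first exact: (submod0 Msm).
  by exists u => //; rewrite uS ?add0r.
- have : I u by rewrite e.
  move=> [m Mm [s Ss um]]; have [t St tu] := H s Ss.
  apply: MS; apply: left_ideal_unit => //; rewrite -tu um addrK; exact: MM.
Qed.

Lemma jac_left_ideal : left_ideal S J.
Proof.
split; first exact: jac_sub.
- split.
    by split=> [|M [/left_ideal_submodule/submod0//]]; exact: (submod0 Ssm).
  move=> x y [Sx Hx] [Sy Hy]; split; first exact: (submodB Ssm).
  move=> M HM; have [/left_ideal_submodule Msm _ _] := HM.
  by apply: (submodB Msm); [exact: Hx|exact: Hy].
- move=> s x Ss [Sx Hx]; split; first exact: SM.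
  by move=> M HM; have [[_ _ MM] _ _] := HM; apply: MM => //; exact: Hx.
Qed.

Lemma jac_submodule : submodule R J.
Proof. exact: left_ideal_submodule jac_left_ideal. Qed.

Lemma jac_mull s x : S s -> J x -> J (s * x).
Proof. by case: jac_left_ideal => _ _; apply. Qed.

Lemma jac_mulr x s : S s -> J x -> J (x * s).
Proof.
move=> Ss Jx; have Sx := jac_sub Jx.
apply/jacP; split=> [|a Sa]; first exact: SM.
set y := a * x; have Sy : S y by exact: SM.
have [_ /(_ (s * a) (SM Ss Sa))[w Sw hw]] := (jacP x).1 Jx.
(* [w] is a left inverse of [u - s * y], and 1 + y (1 - s y)^-1 s is the inverse of 1 - y s. *)
exists (u + y * w * s); first by apply: (submodD Ssm) => //; do 2!apply: SM => //.
rewrite mulrDl uS; last by apply: (submodB Ssm) => //; do 2!apply: SM => //.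
have -> : y * w * s * (u - a * (x * s)) = y * (w * (u - s * a * x)) * s.
  rewrite -!mulrA; congr (_ * (_ * _)).
  by rewrite mulrBr mulrBl (Su1 Ss) (uS Ss) !mulrA.
by rewrite hw (Su1 Sy) /y mulrA subrK.
Qed.

(** The left ideal generated by [u - s * (pi *: x)] contains [u] modulo [pi] S, hence contains [u]
    by Nakayama. *)
Lemma jac_uni x : S x -> J (pi *: x).
Proof.
move=> Sx; have Spx : S (pi *: x) by apply: (submodZ Ssm) => //; exact: (dvr_uni HR).
apply/jacP; split=> // s Ss.
have Sv : S (u - s * (pi *: x)) by apply: (submodB Ssm) => //; exact: SM.
pose I : set A := [set y | exists2 t, S t & t * (u - s * (pi *: x)) = y].
have HI : left_ideal S I.
  split; first by move=> _ [t St <-]; exact: SM.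
  - split; first by exists 0; rewrite ?mul0r //; exact: (submod0 Ssm).
    by move=> _ _ [t St <-] [t' St' <-]; exists (t - t'); rewrite ?mulrBl //; exact: (submodB Ssm).
  - by move=> r _ Sr [t St <-]; exists (r * t); rewrite ?mulrA //; exact: SM.
apply: (left_ideal_nakayama HI); exists (s * x), (u - s * (pi *: x)); split.
- exact: SM.
- by exists u => //; rewrite uS.
- by rewrite -scalerAr subrK.
Qed.

Lemma jac_nil x : S x -> (forall s, S s -> exists n, J ((s * x) ^+ n.+1)) -> J x.
Proof.
move=> Sx H; apply/jacP; split=> // s Ss; have [n] := H s Ss.
move: (s * x) (SM Ss Sx) => y Sy /jacP[_ /(_ u Su)[t St]].
have SX k : S (y ^+ k.+1).
  by elim: k => [|k IH]; rewrite ?expr1 // exprS; exact: SM.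
rewrite (uS (SX n)).
(* [g] is the geometric sum u + y + ... + y^n. *)
have [g Sg <-] : exists2 g, S g & g * (u - y) = u - y ^+ n.+1.
  elim: n {t St} => [|n [g Sg IH]].
    by exists u => //; rewrite uS ?expr1 //; exact: (submodB Ssm).
  exists (u + g * y); first by apply: (submodD Ssm) => //; exact: SM.
  rewrite mulrDl uS; last exact: (submodB Ssm).
  have -> : g * y * (u - y) = (g * (u - y)) * y.
    by rewrite -!mulrA; congr (g * _); rewrite mulrBr mulrBl (Su1 Sy) (uS Sy).
  by rewrite IH mulrBl uS // -exprSr addrA subrK.
by move=> e; exists (t * g); [exact: SM|rewrite -mulrA].
Qed.

Lemma jac_semiprime x : S x -> (forall s, S s -> J (x * s * x)) -> J x.
Proof.
move=> Sx H; apply: jac_nil => // s Ss; exists 1%N.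
by rewrite expr2 -mulrA; apply: jac_mull => //; rewrite mulrA; exact: H.
Qed.

Lemma jac_idem x : J x -> x * x = x -> x = 0.
Proof.
move=> Jx xx; have Sx := jac_sub Jx.
have [_ /(_ u Su)[t St e]] := (jacP x).1 Jx.
by rewrite -[LHS](uS Sx) -e uS // -mulrA mulrBl uS // xx subrr mulr0.
Qed.

(** Semisimplicity of S / J. [N] is minimal among the left ideals containing J with I + N = S. If
    some [x] in I ∩ N is not in J, a maximal left ideal [M] avoids it; then (I ∩ N) + M = S, so I +
    (N ∩ M) is still S, against minimality. *)
Lemma jac_complement I : left_ideal S I -> J `<=` I ->
  exists N, [/\ left_ideal S N, J `<=` N, I `&` N `<=` J &
    exists a n, [/\ I a, N n & u = a + n]].
Proof.
move=> HI JI; have Ism := left_ideal_submodule HI.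
pose P N := [/\ left_ideal S N, J `<=` N & exists a n, [/\ I a, N n & u = a + n]].
have [||N [HN JN uN] Nmin] := @between_min _ _ _ HR _ J P jac_submodule.
- move=> N [HN JN _]; split=> //; first exact: left_ideal_submodule.
  by move=> x Nx; apply: jac_uni; case: HN => + _ _; apply.
- exists S; split; [|exact: jac_sub|].
    by split=> //; split; [exact: submod0|exact: submodB].
  by exists 0, u; rewrite add0r; split=> //; exact: (submod0 Ism).
exists N; split=> // x [Ix Nx]; apply: contrapT => Jx.
have [M HM Mx] : exists2 M, maximal_left_ideal S M & ~ M x.
  apply: contrapT => H; apply: Jx; split; first by case: HI => + _ _; apply.
  by move=> M HM; apply: contrapT => Mx; apply: H; exists M.
have [LM MS Mmax] := HM; have Msm := left_ideal_submodule LM.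
have [MS' _ MM] := LM; have Nsm := left_ideal_submodule HN.
have [NS _ NM] := HN; have [_ _ IM] := HI.
pose Y : set A := [set y | exists2 m, M m & exists b, [/\ I b, N b & y = b + m]].
have HY : left_ideal S Y.
  split.
  - by move=> _ [m Mm [b [_ Nb ->]]]; apply: (submodD Ssm); [exact: NS|exact: MS'].
  - split; first by exists 0; [exact: submod0|exists 0; rewrite addr0; split=> //; exact: submod0].
    move=> _ _ [m Mm [b [Ib Nb ->]]] [m' Mm' [b' [Ib' Nb' ->]]]; exists (m - m').
      exact: (submodB Msm).
    by exists (b - b'); rewrite opprD addrACA; split=> //; [exact: (submodB Ism)|exact: (submodB Nsm)].
  - move=> r _ Sr [m Mm [b [Ib Nb ->]]]; exists (r * m); first exact: MM.
    by exists (r * b); rewrite mulrDr; split=> //; [exact: IM|exact: NM].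
have YS : Y = S.
  have [|e|//] := Mmax Y HY.
    by move=> m Mm; exists m => //; exists 0; rewrite add0r; split=> //; exact: submod0.
  case: Mx; rewrite -e; exists 0; first exact: submod0.
  by exists x; rewrite addr0.
have [a [n [Ia Nn e]]] := uN.
have : Y n by rewrite YS; exact: NS.
move=> [m Mm [b [Ib Nb nb]]].
suff NM' : N `&` M = N.
  by apply: Mx; have [_] : (N `&` M) x by rewrite NM'.
apply: Nmin; last by move=> ? [].
split.
- split; first by move=> y [/NS].
  + split; first by split; exact: submod0.
    by move=> y y' [? ?] [? ?]; split; exact: submodB.
  + by move=> s y Ss [Ny My]; split; [exact: NM|exact: MM].
- by move=> y Jy; split; [exact: JN|case: Jy => _; apply].
- exists (a + b), m; split; first exact: (submodD Ism).
    by split=> //; rewrite -(addKr b m) -nb; apply: (submodD Nsm) => //; exact: (submodN Nsm).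
  by rewrite e nb addrA.
Qed.

(** For a two-sided [I], I N lies in I ∩ N ⊆ J. The other order follows from semiprimeness, since n
    a s n a contains the factor a s n, which is in I N. *)
Lemma jac_complement2 I : twosided_ideal S I -> J `<=` I ->
  exists N, [/\ left_ideal S N, J `<=` N, exists a n, [/\ I a, N n & u = a + n],
    forall a n, I a -> N n -> J (a * n) & forall a n, I a -> N n -> J (n * a)].
Proof.
move=> [HI Ir] JI; have [N [HN JN IN uN]] := jac_complement HI JI.
have [IS _ IM] := HI; have [NS _ NM] := HN.
have H a n : I a -> N n -> J (a * n).
  by move=> Ia Nn; apply: IN; split; [apply: Ir => //; exact: NS|apply: NM => //; exact: IS].
exists N; split=> // a n Ia Nn.
have [Sa Sn] := (IS _ Ia, NS _ Nn).
apply: jac_semiprime; first exact: SM.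
move=> s Ss; rewrite -!mulrA; apply: jac_mull => //; rewrite !mulrA; apply: jac_mulr => //.
by apply: H => //; apply: Ir.
Qed.

(** * Powers of the radical and Nakayama's lemma for subsets *)

Fixpoint jac_pow n : set A := if n is n'.+1 then set_prod J (jac_pow n') else S.

Lemma jac_pow_submodule n : submodule R (jac_pow n).
Proof. by case: n => [|n] //=; apply: set_prod_submodule; exact: jac_submodule. Qed.

Lemma jac_pow_mull n s x : S s -> jac_pow n x -> jac_pow n (s * x).
Proof.
case: n => [|n] Ss /=; first exact: SM.
by apply: set_prod_mull => y; exact: jac_mull.
Qed.

Lemma jac_pow_sub n : jac_pow n `<=` S.
Proof.
elim: n => [|n IH] //=; apply: set_prod_min; [exact: submod0|exact: submodD|].
by move=> x y Jx /IH Sy; apply: SM => //; exact: jac_sub.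
Qed.

Lemma jac_powSr n x y : jac_pow n x -> J y -> jac_pow n.+1 (x * y).
Proof.
move=> + Jy; elim: n x => [|n IH] x.
  move=> Sx; rewrite -(Su1 (jac_sub (jac_mull Sx Jy))); apply: set_prod_mem => //.
  exact: jac_mull.
by apply: set_prod_mulr => z; exact: IH.
Qed.

Lemma jac_pow_mono n : jac_pow n.+1 `<=` jac_pow n.
Proof.
apply: set_prod_min; [exact: submod0 (jac_pow_submodule n)|exact: submodD (jac_pow_submodule n)|].
by move=> x y Jx; apply: jac_pow_mull; exact: jac_sub.
Qed.

(** J is nilpotent modulo [pi] S. The descending ideals J^n + [pi] S become stationary at some
    [Q n]. If [Q n] were larger than [pi] S, it would have a maximal proper left subideal [N]; the
    radical kills the simple quotient, so [Q n.+1], which equals [Q n], would lie in [N]. *)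
Lemma jac_pow_uni : exists r, forall x, jac_pow r x -> exists2 y, S y & x = pi *: y.
Proof.
pose B : set A := [set x | exists2 y, S y & x = pi *: y].
have HB : submodule R B.
  split; first by exists 0; [exact: (submod0 Ssm)|rewrite scaler0].
    by move=> _ _ [x Sx ->] [y Sy ->]; exists (x - y); [exact: (submodB Ssm)|rewrite scalerBr].
  by move=> r _ Rr [x Sx ->]; exists (r *: x); [exact: (submodZ Ssm)|rewrite scalerA mulrC -scalerA].
have BM s x : S s -> B x -> B (s * x).
  by move=> Ss [y Sy ->]; exists (s * y); [exact: SM|rewrite -scalerAr].
have BS : B `<=` S by move=> _ [y Sy ->]; apply: (submodZ Ssm) => //; exact: (dvr_uni HR).
pose Q n : set A := set_sum (jac_pow n) B.
have QS n : left_ideal S (Q n).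
  have Hn := jac_pow_submodule n; split.
  - by move=> _ [x /jac_pow_sub Sx [y /BS Sy ->]]; exact: (submodD Ssm).
  - split; first by exists 0; [exact: submod0|exists 0; rewrite ?addr0 //; exact: submod0].
    move=> _ _ [x Hx [b Bb ->]] [x' Hx' [b' Bb' ->]]; exists (x - x'); first exact: (submodB Hn).
    by exists (b - b'); [exact: (submodB HB)|rewrite opprD addrACA].
  - move=> s _ Ss [x Hx [b Bb ->]]; exists (s * x); first exact: jac_pow_mull.
    by exists (s * b); [exact: BM|rewrite mulrDr].
have BQ n : B `<=` Q n.
  by move=> x Bx; exists 0; [exact: submod0 (jac_pow_submodule n)|exists x; rewrite ?add0r].
pose P X := exists n, X = Q n.
have [||_ [n ->] Xmin] := @between_min _ _ _ HR _ B P HB.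
- move=> _ [n ->]; split=> //; first exact: left_ideal_submodule.
  by move=> x Qx; exists x => //; case: (QS n) => + _ _; apply.
- by exists (Q 0%N), 0%N.
have QSn : Q n.+1 = Q n.
  apply: Xmin; first by exists n.+1.
  by move=> _ [x Hx [b Bb ->]]; exists x; [exact: jac_pow_mono|exists b].
suff QB : Q n `<=` B.
  exists n => x Hx; apply: QB; exists x => //; exists 0; rewrite ?addr0 //; exact: submod0.
apply: contrapT => QB.
have Qsm := left_ideal_submodule (QS n).
pose P' X := [/\ left_ideal S X, B `<=` X, X `<=` Q n & X <> Q n].
have [||N [HN BN NQ NnQ] Nmax] := @between_max _ _ _ HR _ B P' HB.
- move=> X [HX BX XQ _]; split=> //; first exact: left_ideal_submodule.
  by move=> x Qx; exists x => //; case: HX => + _ _; apply.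
- exists B; split=> //; first by split=> //; split; [exact: submod0|exact: submodB].
  by move=> e; apply: QB; rewrite -e.
have [x Qx Nx] : exists2 x, Q n x & ~ N x.
  apply: contrapT => H; apply: NnQ; apply/seteqP; split=> // x Qx.
  by apply: contrapT => Nx; apply: H; exists x.
have Nsm := left_ideal_submodule HN.
have [NS _ NM] := HN; have [QnS _ QM] := QS n.
(* Otherwise [N] and [j * y] generate [Q n], so y = m + s j y with [m] in [N]; a left inverse of
   [u - s * j] then puts [y] into [N]. *)
have JN y j : Q n y -> J j -> N (j * y).
  move=> Qy Jj; apply: contrapT => Njy.
  pose T : set A := [set z | exists2 m, N m & exists2 s, S s & z = m + s * (j * y)].
  have Sj := jac_sub Jj; have Qjy : Q n (j * y) by exact: QM.
  have [TQ|TQ] := pselect (T = Q n); last first.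
    have NT : N `<=` T.
      move=> m Nm; exists m => //; exists 0; first exact: submod0.
      by rewrite mul0r addr0.
    have TN : T = N.
      apply: Nmax => //; split=> //.
      + split.
        * move=> _ [m Nm [s Ss ->]]; apply: (submodD Ssm); first exact: NS.
          by apply: SM => //; exact: QnS.
        * split; first by exists 0; [exact: submod0|exists 0; [exact: submod0|rewrite mul0r addr0]].
          move=> _ _ [m Nm [s Ss ->]] [m' Nm' [s' Ss' ->]]; exists (m - m').
            exact: (submodB Nsm).
          by exists (s - s'); [exact: (submodB Ssm)|rewrite mulrBl opprD addrACA].
        * move=> r _ Sr [m Nm [s Ss ->]]; exists (r * m); first exact: NM.
          by exists (r * s); [exact: SM|rewrite mulrDr mulrA].
      + by move=> b Bb; apply: NT; exact: BN.
      + move=> _ [m Nm [s Ss ->]]; apply: (submodD Qsm); first exact: NQ.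
        exact: QM.
    apply: Njy; rewrite -TN; exists 0; first exact: submod0.
    by exists u; rewrite // add0r uS //; exact: QnS.
  have : T y by rewrite TQ.
  move=> [m Nm [s Ss e]].
  have [_ /(_ s Ss)[t St tu]] := (jacP j).1 Jj.
  have Sy := QnS _ Qy.
  have Ny : N y.
    rewrite -(uS Sy) -tu -mulrA mulrBl (uS Sy) {1}e -mulrA addrK.
    exact: NM.
  exact: Njy (NM _ _ Sj Ny).
apply: Nx; move: x Qx; rewrite -QSn => _ [y Hy [b Bb ->]].
apply: (submodD Nsm); last exact: BN.
move: y Hy; apply: set_prod_min; [exact: submod0|exact: submodD|].
move=> j y Jj Hy; apply: JN => //; exists y => //; exists 0; rewrite ?addr0 //; exact: submod0.
Qed.

Lemma jac_pow_deep m : exists k, forall x, jac_pow k x -> exists2 y, S y & x = pi ^+ m *: y.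
Proof.
have [r Hr] := jac_pow_uni.
have step n x : jac_pow (n + r) x -> exists2 y, jac_pow n y & x = pi *: y.
  elim: n x => [|n IH] x; first exact: Hr.
  rewrite addSn; move: x; apply: set_prod_min.
  - by exists 0; rewrite ?scaler0 //; exact: set_prod0.
  - by move=> _ _ [x Hx ->] [y Hy ->]; exists (x + y); [exact: set_prodD|rewrite scalerDr].
  - move=> j x Jj /IH[y Hy ->]; exists (j * y); last by rewrite scalerAr.
    exact: set_prod_mem.
elim: m => [|m [k Hk]].
  by exists 0%N => x Sx; exists x; rewrite // expr0 scale1r.
exists (k + r)%N => x /step[y /Hk[z Sz ->] ->].
by exists z; rewrite // scalerA -exprS.
Qed.

Lemma jac_pow_cap x : (forall n, jac_pow n x) -> x = 0.
Proof.
move=> H; apply: (lattice_capX HR (ord_lattice HS)) => m.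
by have [k] := jac_pow_deep m; apply.
Qed.

(** Iterating the inclusion puts [N] into every power of J, and these meet in 0. [N] may be any
    subset of [S], which allows off-diagonal blocks, and the radical may act on either side. *)
Lemma jac_nakayama N : N `<=` S ->
  N `<=` set_sum (set_prod J N) (set_prod N J) -> N `<=` [set 0].
Proof.
move=> NS H; have Nn n : N `<=` jac_pow n.
  elim: n => [|n IH] // x /H[a Ha [b Hb ->]].
  have Hn := jac_pow_submodule n.+1.
  apply: (submodD Hn).
    move: a Ha; apply: set_prod_min; [exact: set_prod0|exact: set_prodD|].
    by move=> j y Jj /IH Hy; exact: set_prod_mem.
  move: b Hb; apply: set_prod_min; [exact: set_prod0|exact: set_prodD|].
  by move=> y j /IH; exact: jac_powSr.
by move=> x Nx; apply: jac_pow_cap => n; exact: Nn.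
Qed.

Section Corner.
Variables (e : A) (Se : S e) (ee : e * e = e).

Lemma cornerP x : corner e S x <-> [/\ S x, e * x = x & x * e = x].
Proof.
split=> [[y Sy <-]|[Sx ex xe]]; last by exists x; rewrite // ex xe.
by split; [do 2!apply: SM => //|rewrite !mulrA ee|rewrite -mulrA ee].
Qed.

Lemma corner_order : order_with e (corner e S).
Proof.
split.
- apply: lattice_sub (ord_lattice HS) _ _ => //; last by move=> x /cornerP[].
  split.
  + by apply/cornerP; rewrite mulr0 mul0r; split=> //; exact: submod0.
  + move=> x y /cornerP[Sx ex xe] /cornerP[Sy ey ye]; apply/cornerP.
    by rewrite mulrBr mulrBl ex xe ey ye; split=> //; exact: submodB.
  + move=> r x Rr /cornerP[Sx ex xe]; apply/cornerP.
    by rewrite -scalerAr -scalerAl ex xe; split=> //; exact: submodZ.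
- move=> x y /cornerP[Sx ex xe] /cornerP[Sy ey ye]; apply/cornerP.
  by rewrite mulrA ex -mulrA ye; split=> //; exact: SM.
- by apply/cornerP.
- by move=> x /cornerP[].
- by move=> x /cornerP[].
Qed.

End Corner.
End OneOrder.

Lemma jac_corner u S e : order_with u S -> S e -> e * e = e ->
  forall x, jacobson (corner e S) x <-> [/\ jacobson S x, e * x = x & x * e = x].
Proof.
move=> HS Se ee x; have HC := corner_order HS Se ee.
have Ssm : submodule R S by case: (ord_lattice HS).
have CP := cornerP HS Se ee; have [Su SM] := (ord_one HS, ordM HS).
have [uS Su1] := (ord_mul1 HS, ord_1mul HS).
split.
  move=> /(jacP HC)[/CP[Sx ex xe] H]; split=> //; apply/(jacP HS); split=> // s Ss.
  have [|t /CP[St et te] tx] := H (e * s * e); first by exists s.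
  have Sx1 : S (s * x) by exact: SM.
  (* [t] is a left inverse of [e - (e * s * e) * x] in the corner; since x e = x, this is again the
     identity (1 + s x t)(1 - s x) = 1. *)
  exists (u + s * x * t); first by apply: (submodD Ssm) => //; do 2!apply: SM => //.
  rewrite mulrDl uS; last exact: (submodB Ssm).
  rewrite -mulrA mulrBr (Su1 _ St).
  have -> : t - t * (s * x) = e.
    rewrite -tx mulrBr te; congr (_ - _).
    by rewrite -[e * s * e * x]mulrA ex !mulrA te.
  by rewrite -mulrA xe subrK.
move=> [Jx ex xe]; have Sx := jac_sub Jx; apply/(jacP HC); split; first exact/CP.
move=> s /CP[Ss es se].
have [_ /(_ s Ss)[t St tu]] := (jacP HS x).1 Jx.
exists (e * t * e); first by exists t.
have Sx1 : S (s * x) by exact: SM.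
have -> : e * t * e * (e - s * x) = e * (t * (u - s * x)) * e.
  rewrite -!mulrA; congr (_ * (_ * _)).
  by rewrite mulrBr mulrBl ee !mulrA es uS // -mulrA xe.
by rewrite tu (Su1 _ Se) ee.
Qed.

End Orders.

(** * A criterion for hereditary orders *)

Definition subring_set (A : nzRingType) (S : set A) : Prop :=
  [/\ S 1, forall x y, S x -> S y -> S (x - y) & forall x y, S x -> S y -> S (x * y)].

Section SubringType.
Variables (A : nzRingType) (S : set A) (HS : subring_set S).

(** Indexed by the proof [HS], so that the closure instance can be attached to the predicate and the
    ring structure of [subring_type] is inferred from it. *)
Definition subring_pred of subring_set S : {pred A} := [pred x | `[< S x >]].

Lemma subring_predE x : (x \in subring_pred HS) <-> S x.
Proof. by rewrite unfold_in; split=> /asboolP. Qed.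

Lemma subring_pred_closed : subring_closed (subring_pred HS).
Proof.
case: (HS) => S1 SB SM; split; first exact/subring_predE.
  by move=> x y /subring_predE Sx /subring_predE Sy; apply/subring_predE; exact: SB.
by move=> x y /subring_predE Sx /subring_predE Sy; apply/subring_predE; exact: SM.
Qed.

HB.instance Definition _ := GRing.isSubringClosed.Build A (subring_pred HS) subring_pred_closed.

Record subring_type := SubringType { subring_val :> A; _ : subring_val \in subring_pred HS }.

HB.instance Definition _ := [isSub for subring_val].
HB.instance Definition _ := [Choice of subring_type by <:].
HB.instance Definition _ := [SubChoice_isSubNzRing of subring_type by <:].

Lemma subring_valP (x : subring_type) : S (val x).
Proof. by apply/subring_predE; exact: valP. Qed.

Lemma subring_valK x : S x -> exists y : subring_type, val y = x.
Proof. by move=> /subring_predE Sx; exists (SubringType Sx). Qed.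

End SubringType.

Section Hereditary.
Variables (K : fieldType) (R : set K) (pi : K) (HR : dvr_spec R pi).
Variables (A : falgType K) (S : set A) (HS : order_with R 1 S).
Hypothesis Sfull : forall a, exists n, S (pi ^+ n *: a).
Implicit Types L M N P : set A.
Notation J := (jacobson S).

Let submod0 L := @submod0 K R A L.
Let submodB L := @submodB K R A L.
Let submodD L := @submodD K R A L.
Let submodZ L := @submodZ K R A L.
Let Ssm : submodule R S. Proof. by case: (ord_lattice HS). Qed.
Let SM := ordM HS.
Let S1 := ord_one HS.

Definition left_module L : Prop :=
  submodule R L /\ forall s x, S s -> L x -> L (s * x).

(* The homomorphisms L -> S given by right multiplications. *)
Definition right_colon L : set A := [set y | forall x, L x -> S (x * y)].

Lemma left_ideal_module I : left_ideal S I -> left_module I.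
Proof. by move=> HI; split; [exact: (left_ideal_submodule HS HI)|case: HI]. Qed.

Lemma jac_prod_module P : left_module P -> left_module (set_prod J P).
Proof.
move=> [Psm PM]; split; first exact: (set_prod_submodule HR) _ (jac_submodule HS).
by move=> s x Ss; move: x; apply: set_prod_mull => j; exact: (jac_mull HS Ss).
Qed.

(** Semisimplicity of P / J P. [N] is maximal with N ∩ M ⊆ J P. For [x] outside M + N, the left
    ideal [I] of all s with s x in M + N contains J; a complement [I'] of it modulo J gives N + I'
    x, which violates maximality. *)
Lemma jac_prod_complement P M : left_module P -> left_module M ->
  set_prod J P `<=` M -> M `<=` P ->
  exists N, [/\ left_module N, N `<=` P, forall x, N x -> M x -> set_prod J P x &
    forall x, P x -> exists m n, [/\ M m, N n & x = m + n]].
Proof.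
move=> HP HM JM MP; have HJ := jac_prod_module HP.
have [Psm PM] := HP; have [Msm MM] := HM; have [JPsm JPM] := HJ.
pose Q N := [/\ left_module N, set_prod J P `<=` N, N `<=` P &
  forall x, N x -> M x -> set_prod J P x].
have [||N [HN JN NP NM] Nmax] := @between_max _ _ _ HR _ _ Q JPsm.
- move=> N [[Nsm _] JN NP _]; split=> // x /NP Px.
  rewrite -[x]mul1r scalerAl; apply: set_prod_mem => //.
  exact: (jac_uni HR HS S1).
- by exists (set_prod J P); split=> [//|x|x /JM/MP|x].
exists N; split=> // x Px; apply: contrapT => Hx.
have [Nsm NM'] := HN.
pose T : set A := [set y | exists m n, [/\ M m, N n & y = m + n]].
have T0 : T 0 by exists 0, 0; rewrite addr0; split=> //; exact: submod0.
have TB y z : T y -> T z -> T (y - z).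
  move=> [m [n [Mm Nn ->]]] [m' [n' [Mm' Nn' ->]]]; exists (m - m'), (n - n').
  by rewrite opprD addrACA; split=> //; [exact: (submodB Msm)|exact: (submodB Nsm)].
have TM s y : S s -> T y -> T (s * y).
  move=> Ss [m [n [Mm Nn ->]]]; exists (s * m), (s * n).
  by rewrite mulrDr; split=> //; [exact: MM|exact: NM'].
have TN y : N y -> T y by exists 0, y; rewrite add0r; split=> //; exact: submod0.
pose I : set A := [set s | S s /\ T (s * x)].
have HI : left_ideal S I.
  split; first by move=> s [].
  - split; first by split; [exact: submod0|rewrite mul0r].
    by move=> s s' [Ss Ts] [Ss' Ts']; split; [exact: submodB|rewrite mulrBl; exact: TB].
  - by move=> r s Sr [Ss Ts]; split; [exact: SM|rewrite -mulrA; exact: TM].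
have JI : J `<=` I.
  move=> j Jj; split; first exact: (jac_sub Jj).
  by apply: TN; apply: JN; exact: set_prod_mem.
have [I' [HI' JI' II' [a [n [Ia I'n e]]]]] := jac_complement HR HS HI JI.
have [I'sm I'M] := left_ideal_module HI'; have [I'S _ _] := HI'.
pose N' : set A := [set y | exists n i, [/\ N n, I' i & y = n + i * x]].
have NN' : N `<=` N'.
  by move=> y Ny; exists y, 0; rewrite mul0r addr0; split=> //; exact: submod0.
suff N'N : N' = N.
  have : T (n * x).
    apply: TN; rewrite -N'N; exists 0, n; rewrite add0r; split=> //; exact: submod0.
  case: Ia => _ Ta Tn; apply: Hx; suff : T x by [].
  rewrite -[x]mul1r e mulrDl -[n * x]opprK; apply: (TB) => //.
  by rewrite -sub0r; apply: TB.
apply: Nmax => //; split=> //.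
- split; first split.
  + by apply: NN'; exact: submod0.
  + move=> _ _ [m [i [Nm Ii ->]]] [m' [i' [Nm' Ii' ->]]]; exists (m - m'), (i - i').
    by rewrite mulrBl opprD addrACA; split=> //; [exact: (submodB Nsm)|exact: (submodB I'sm)].
  + move=> r _ Rr [m [i [Nm Ii ->]]]; exists (r *: m), (r *: i).
    by rewrite scalerDr scalerAl; split=> //; [exact: (submodZ Nsm)|exact: (submodZ I'sm)].
  + move=> s _ Ss [m [i [Nm Ii ->]]]; exists (s * m), (s * i).
    by rewrite mulrDr mulrA; split=> //; [exact: NM'|exact: I'M].
- by move=> y /JN/NN'.
- move=> _ [m [i [Nm Ii ->]]]; apply: (submodD Psm); first exact: NP.
  by apply: PM => //; exact: I'S.
- move=> _ [m [i [Nm Ii ->]]] Mmi; apply: NM => //; apply: (submodD Nsm) => //.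
  apply: JN; apply: set_prod_mem => //; apply: II'; split=> //; split; first exact: I'S.
  exists (m + i * x), (- m); rewrite addrAC subrr add0r; split=> //.
  by rewrite -sub0r; apply: (submodB Nsm) => //; exact: submod0.
Qed.

Hypothesis Jinv : set_prod (right_colon J) J 1.

(** A relation 1 = Σ y x with [P y] ⊆ S and [x] in [P] is a dual basis of [P]. Inserting 1 = Σ b j
    from [Jinv] between the factors gives Σ (y b)(j x), where [j x] is in J P and [y b] sends J P
    into J b ⊆ S. *)
Lemma dual_basis_jac P : left_module P -> set_prod (right_colon P) P 1 ->
  set_prod (right_colon (set_prod J P)) (set_prod J P) 1.
Proof.
move=> [Psm PM]; apply: set_prod_min; [exact: set_prod0|exact: set_prodD|].
move=> y x Py Px; rewrite -[x]mul1r.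
move: (1) Jinv; apply: set_prod_min.
- by rewrite mul0r mulr0; exact: set_prod0.
- by move=> a b Ha Hb; rewrite mulrDl mulrDr; exact: set_prodD.
- move=> b j Jb Jj; rewrite -[b * j * x]mulrA mulrA; apply: set_prod_mem; last exact: set_prod_mem.
  apply: set_prod_min => [|? ? ? ?|j' p Jj' Pp]; first by rewrite mul0r; exact: submod0.
    by rewrite mulrDl; exact: submodD.
  rewrite mulrA; apply: Jb; rewrite -mulrA; apply: (jac_mulr HR HS) => //; exact: Py.
Qed.

(* If N complements M modulo J P, then M + N -> P splits off J P, so M is projective with P and J P. *)
Lemma dual_basis_step P M : left_module P -> left_module M ->
  set_prod J P `<=` M -> M `<=` P ->
  set_prod (right_colon P) P 1 -> set_prod (right_colon M) M 1.
Proof.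
move=> HP HM JM MP P1; have [N [HN NP NM PMN]] := jac_prod_complement HP HM JM MP.
have [Msm MM] := HM; have [Nsm NM'] := HN.
have [p [q [e Hp Hq]]] : exists p q, [/\ 1 = p + q, set_prod (right_colon M) M p &
    forall x, P x -> N (x * q)].
  move: (1) P1; apply: set_prod_min.
  - exists 0, 0; rewrite addr0; split=> //; first exact: set_prod0.
    by move=> x _; rewrite mulr0; exact: submod0.
  - move=> _ _ [p [q [-> Hp Hq]]] [p' [q' [-> Hp' Hq']]]; exists (p + p'), (q + q').
    rewrite addrACA; split=> //; first exact: set_prodD.
    by move=> x Px; rewrite mulrDr; apply: (submodD Nsm); [exact: Hq|exact: Hq'].
  - move=> y _ Py /PMN[m [n [Mm Nn ->]]]; exists (y * m), (y * n); rewrite mulrDr.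
    split=> //; first by apply: set_prod_mem => // x /MP; exact: Py.
    by move=> x Px; rewrite mulrA; apply: NM' => //; exact: Py.
have Mp x : M x -> M (x * p).
  move=> Mx; move: p {e} Hp; apply: set_prod_min => [|a b|y m My Mm].
  - by rewrite mulr0; exact: submod0.
  - by rewrite mulrDr; exact: submodD.
  - by rewrite mulrA; apply: MM => //; exact: My.
have Mq x : M x -> set_prod J P (x * q).
  move=> Mx; apply: NM; first by apply: Hq; exact: MP.
  have -> : x * q = x - x * p by rewrite -[in X in X - _](mulr1 x) e mulrDr addrC addKr.
  by apply: (submodB Msm) => //; exact: Mp.
(* Multiplication by [q] sends [M] into M ∩ N ⊆ J P, so multiplying [q] by a dual basis of J P on
   the right gives a dual basis expression for [M]. *)
rewrite [X in set_prod _ _ X]e; apply: set_prodD => //; rewrite -[q]mulr1.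
move: (1) (dual_basis_jac HP P1); apply: set_prod_min => [|a b|y x Hy Hx].
- by rewrite mulr0; exact: set_prod0.
- by rewrite mulrDr; exact: set_prodD.
- rewrite mulrA; apply: set_prod_mem; last exact: JM.
  by move=> z Mz; rewrite mulrA; apply: Hy; exact: Mq.
Qed.

Lemma dual_basis_full L : left_ideal S L -> (exists n, L (pi ^+ n *: 1)) ->
  set_prod (right_colon L) L 1.
Proof.
move=> HL [m Lm]; have [Lsm LM] := left_ideal_module HL; have [LS _ _] := HL.
pose Li i := set_sum L (jac_pow S i).
have HLi i : left_module (Li i).
  have Hi := jac_pow_submodule HR HS i; split; first split.
  - by exists 0; [exact: submod0|exists 0; rewrite ?addr0 //; exact: submod0].
  - move=> _ _ [x Lx [y Hy ->]] [x' Lx' [y' Hy' ->]]; exists (x - x'); first exact: (submodB Lsm).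
    by exists (y - y'); [exact: (submodB Hi)|rewrite opprD addrACA].
  - move=> r _ Rr [x Lx [y Hy ->]]; exists (r *: x); first exact: (submodZ Lsm).
    by exists (r *: y); [exact: (submodZ Hi)|rewrite scalerDr].
  - move=> s _ Ss [x Lx [y Hy ->]]; exists (s * x); first exact: LM.
    by exists (s * y); [exact: (jac_pow_mull HS Ss Hy)|rewrite mulrDr].
have dbi i : set_prod (right_colon (Li i)) (Li i) 1.
  elim: i => [|i]; last first.
    apply: dual_basis_step; [exact: HLi|exact: HLi| |].
    - have [Hsm HM] := HLi i.+1; apply: set_prod_min; [exact: submod0|exact: submodD|].
      move=> j _ Jj [x Lx [y Hy ->]]; exists (j * x); first by apply: LM => //; exact: (jac_sub Jj).
      by exists (j * y); [exact: set_prod_mem|rewrite mulrDr].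
    - by move=> _ [x Lx [y Hy ->]]; exists x => //; exists y => //; exact: (jac_pow_mono HR HS Hy).
  rewrite -[1]mulr1; apply: set_prod_mem.
    by move=> _ [x Lx [y Hy ->]]; rewrite mulr1; apply: (submodD Ssm) => //; exact: LS.
  by exists 0; [exact: submod0|exists 1; rewrite ?add0r].
(* The chain reaches [L] at step [k], because J^k ⊆ [pi]^m S ⊆ L. *)
have [k Hk] := jac_pow_deep HR HS m.
suff <- : Li k = L by exact: dbi.
apply/seteqP; split; last by move=> x Lx; exists x => //; exists 0; rewrite ?addr0 //; exact: (submod0 (jac_pow_submodule HR HS k)).
move=> _ [x Lx [y /Hk[z Sz ->] ->]]; apply: (submodD Lsm) => //.
by rewrite -[z]mulr1 scalerAr; exact: LM.
Qed.

Hypothesis Ass : semisimple_algebra A.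

(** Let V = K L and let [W] be a complementary left ideal of A. The left ideal L + (S ∩ W) is full,
    so it has a dual basis; its part [p] coming from [L] satisfies x - x p in V ∩ W = 0 for [x] in
    [L]. *)
Lemma dual_basis_left_ideal L : left_ideal S L ->
  exists2 a, set_prod (right_colon L) L a & forall x, L x -> x * a = x.
Proof.
move=> HL; have [Lsm LM] := left_ideal_module HL; have [LS _ _] := HL.
have [s Ls] := lattice_fg HR (lattice_sub (ord_lattice HS) Lsm LS).
have LV : L `<=` [set x | x \in <<s>>%VS].
  rewrite Ls; apply: rspan_min; last by move=> x xs; exact: memv_span.
  by split; [exact: mem0v|move=> x y; exact: rpredB|move=> r x _; exact: memvZ].
have VL x : x \in <<s>>%VS -> exists n, L (pi ^+ n *: x).
  by rewrite Ls; exact: (rspan_full HR).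
have Vl : (fullv * <<s>> <= <<s>>)%VS.
  apply/prodvP => a x _ /VL[n Ln]; have [m Sm] := Sfull a.
  have := LV _ (LM _ _ Sm Ln).
  rewrite /= -scalerAl -scalerAr => H.
  rewrite -[X in X \in _](scalerK (uniX_neq0 HR n)) memvZ //.
  by rewrite -[X in X \in _](scalerK (uniX_neq0 HR m)) memvZ.
have [W [Wl VW capVW]] := Ass Vl.
have WM a w : w \in W -> a * w \in W.
  by move=> Ww; apply: (subvP Wl); apply: memv_mul => //; exact: memvf.
pose F : set A := set_sum L [set w | S w /\ w \in W].
have HF : left_ideal S F.
  split.
  - by move=> _ [x Lx [w [Sw _] ->]]; apply: (submodD Ssm) => //; exact: LS.
  - split; first by exists 0; [exact: submod0|exists 0; rewrite ?addr0 //; split; [exact: submod0|exact: mem0v]].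
    move=> _ _ [x Lx [w [Sw Ww] ->]] [x' Lx' [w' [Sw' Ww'] ->]]; exists (x - x').
      exact: (submodB Lsm).
    by exists (w - w'); [split; [exact: submodB|exact: rpredB]|rewrite opprD addrACA].
  - move=> r _ Sr [x Lx [w [Sw Ww] ->]]; exists (r * x); first exact: LM.
    by exists (r * w); [split; [exact: SM|exact: WM]|rewrite mulrDr].
have LF : L `<=` F.
  by move=> x Lx; exists x => //; exists 0; rewrite ?addr0 //; split; [exact: submod0|exact: mem0v].
have F1 : exists n, F (pi ^+ n *: 1).
  have : 1 \in (<<s>> + W)%VS by rewrite VW memvf.
  move=> /memv_addP[v Vv [w Ww e]].
  have [n Ln] := VL v Vv; have [m Sm] := Sfull w.
  exists (n + m)%N; exists (pi ^+ (n + m) *: v).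
    by rewrite addnC exprD -scalerA; apply: submodZ => //; exact: (dvr_uniX HR _).
  exists (pi ^+ (n + m) *: w); last by rewrite e scalerDr.
  split; last exact: memvZ.
  by rewrite exprD -scalerA; apply: submodZ => //; exact: (dvr_uniX HR _).
have [p [q [e Hp Hq]]] : exists p q, [/\ 1 = p + q, set_prod (right_colon L) L p &
    forall x, L x -> x * q \in W].
  move: (1) (dual_basis_full HF F1); apply: set_prod_min.
  - exists 0, 0; rewrite addr0; split=> //; first exact: set_prod0.
    by move=> x _; rewrite mulr0 mem0v.
  - move=> _ _ [p [q [-> Hp Hq]]] [p' [q' [-> Hp' Hq']]]; exists (p + p'), (q + q').
    rewrite addrACA; split=> //; first exact: set_prodD.
    by move=> x Lx; rewrite mulrDr; apply: rpredD; [exact: Hq|exact: Hq'].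
  - move=> y _ Fy [l Ll [w [Sw Ww] ->]]; exists (y * l), (y * w); rewrite mulrDr.
    split=> //; first by apply: set_prod_mem => // x /LF; exact: Fy.
    by move=> x _; rewrite mulrA; exact: WM.
exists p => // x Lx.
have Lxp : L (x * p).
  move: p {e} Hp; apply: set_prod_min => [|a b|y l Ly Ll].
  - by rewrite mulr0; exact: submod0.
  - by rewrite mulrDr; exact: submodD.
  - by rewrite mulrA; apply: LM => //; exact: Ly.
have e' : x * q = x - x * p by rewrite -[in X in X - _](mulr1 x) e mulrDr addrC addKr.
have : x - x * p \in (<<s>> :&: W)%VS.
  by rewrite memv_cap -{2}e' Hq // andbT; apply: LV; exact: submodB.
by rewrite capVW memv0 subr_eq0 => /eqP <-.
Qed.

(** The pairs in [t] form a dual basis of the left ideal: each second component has a preimage under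
    [p] of its value under [g], and the first components supply the coefficients of the lifting. *)
Lemma hereditary_jac_inv : hereditary S.
Proof.
have HSS : subring_set S by split=> // x y; exact: submodB.
exists (subring_type HSS), val; split; first exact: val_inj.
  apply/seteqP; split=> [_ [x _ <-]|x /(subring_valK HSS)[y <-]]; first exact: subring_valP.
  by exists y.
move=> I i iinj M N p g psurj.
pose L : set A := [set x | exists y, x = val (i y)].
have HL : left_ideal S L.
  split; first by move=> _ [y ->]; exact: subring_valP.
  - split; first by exists 0; rewrite linear0.
    by move=> _ _ [x ->] [y ->]; exists (x - y); rewrite linearB.
  - move=> s _ /(subring_valK HSS)[s' <-] [y ->]; exists (s' *: y).
    by rewrite linearZ.
have [_ [t [Ht ->]] aL] := dual_basis_left_ideal HL.
have tL x : L x -> x = \sum_(q <- t) x * q.1 * q.2.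
  by move=> /aL {1}<-; rewrite mulr_sumr; apply: eq_bigr => q _; rewrite mulrA.
have [|m Hm] := @choice _ _ (fun q (r : M * I) =>
    q \in t -> q.2 = val (i r.2) /\ p r.1 = g r.2).
  move=> q.
  have [/Ht[_ [y e]]|_] := boolP (q \in t); last by exists (0, 0).
  by have [x px] := psurj (g y); exists (x, y).
pose c (q : A * A) (x : I) : subring_type HSS := insubd 0 (val (i x) * q.1).
have cE q x : q \in t -> val (c q x) = val (i x) * q.1.
  move=> /Ht[Hq _]; rewrite val_insubd ifT //; apply/subring_predE; apply: Hq.
  by exists x.
pose hf (x : I) : M := \sum_(q <- t) c q x *: (m q).1.
have hlin : linear hf.
  move=> b x y; rewrite /hf scaler_sumr -big_split !big_seq; apply: eq_bigr => q qt /=.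
  rewrite scalerA -scalerDl; congr (_ *: _); apply: val_inj.
  rewrite [RHS]rmorphD rmorphM /= !cE // linearP rmorphD mulrDl; congr (_ + _).
  by rewrite -[b *: i x]/((b : subring_type HSS) * i x) rmorphM mulrA.
pose h : {linear I -> M} := HB.pack hf (GRing.isLinear.Build _ I M _ hf hlin).
exists h => x; rewrite /h /= /hf linear_sum.
have {2}-> : x = \sum_(q <- t) c q x *: (m q).2.
  apply: iinj; apply: val_inj; rewrite [LHS]tL; last by exists x.
  rewrite linear_sum rmorph_sum !big_seq; apply: eq_bigr => q qt.
  by rewrite linearZ rmorphM /= cE // -(Hm q qt).1.
rewrite linear_sum !big_seq; apply: eq_bigr => q qt.
by rewrite !linearZ (Hm q qt).2.
Qed.

End Hereditary.

(** * Duality for the reduced trace *)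

(** For nondegeneracy, a matrix unit in one block of the splitting is an E-combination of images of
    basis elements of A; tracing against it reads off one entry of [rho j a]. All entries vanish,
    and uniqueness of E-coordinates gives a = 0. *)
Lemma reduced_trace_spec (K : fieldType) (A : falgType K) (tr : A -> K) :
  is_reduced_trace tr ->
  [/\ forall c a b, tr (c *: a + b) = c * tr a + tr b,
      forall a b, tr (a * b) = tr (b * a)
    & forall a, (forall b, tr (a * b) = 0) -> a = 0].
Proof.
move=> [E [iota [m [n [rho [[rhoZ Hrho] trE]]]]]].
have iinj : injective iota by exact: fmorph_inj.
split.
- move=> c a b; apply: iinj; rewrite rmorphD rmorphM !trE mulr_sumr -big_split.
  by apply: eq_bigr => j _ /=; rewrite rmorphD rhoZ mxtraceD mxtraceZ.
- move=> a b; apply: iinj; rewrite !trE; apply: eq_bigr => j _.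
  by rewrite !rmorphM /= mxtrace_mulC.
- move=> a Ha; have rho0 j : rho j a = 0.
    apply/matrixP => q p; rewrite mxE.
    pose y k : 'M[E]_((n k).+1) := delta_mx (inord p) (inord q) *+ (k == j).
    have [c [Hc _]] := Hrho y.
    have : \sum_k \tr (rho k a * y k) = 0.
      have -> : \sum_k \tr (rho k a * y k) =
          \sum_i c 0 i * \sum_k \tr (rho k (a * (vbasis {:A})`_i)).
        under [RHS]eq_bigr do rewrite mulr_sumr.
        rewrite exchange_big /=; apply: eq_bigr => k _.
        rewrite {1}(Hc k) mulr_sumr linear_sum; apply: eq_bigr => i _ /=.
        by rewrite -scalerAr mxtraceZ rmorphM.
      by apply: big1 => i _; rewrite -trE Ha rmorph0 mulr0.
    rewrite (bigD1 j) //= big1 ?addr0; last first.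
      by move=> k /negPf kj; rewrite /y kj mulr0 mxtrace0.
    rewrite /y eqxx mulr1n !inord_val /mxtrace.
    rewrite (bigD1 q) //= big1 ?addr0; last first.
      move=> i iq; rewrite !mxE big1 // => l _.
      by rewrite !mxE (negPf iq) andbF mulr0.
    rewrite !mxE (bigD1 p) //= big1 ?addr0 ?mxE ?eqxx ?mulr1 //.
    by move=> l lp; rewrite !mxE (negPf lp) mulr0.
  have [c [Hc cuniq]] := Hrho (fun=> 0).
  pose ca : 'rV[E]_(\dim {:A}) := \row_i iota (coord (vbasis fullv) i a).
  have c0 : c = 0 by apply: cuniq => j; rewrite big1 // => i _; rewrite mxE scale0r.
  have cca : c = ca.
    apply: cuniq => j; rewrite -[LHS](rho0 j) {1}(coord_vbasis (memvf a)) rmorph_sum.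
    by apply: eq_bigr => i _; rewrite rhoZ mxE.
  rewrite (coord_vbasis (memvf a)); apply: big1 => i _.
  suff -> : coord (vbasis fullv) i a = 0 by rewrite scale0r.
  apply: iinj; rewrite rmorph0; have /rowP/(_ i) := etrans (esym cca) c0.
  by rewrite !mxE.
Qed.

Section Duality.
Variables (K : fieldType) (R : set K) (pi : K) (HR : dvr_spec R pi).
Variables (A : falgType K) (tau : {scalar A}).
Hypothesis tauC : forall a b, tau (a * b) = tau (b * a).
Hypothesis tau_nondeg : forall a, (forall b, tau (b * a) = 0) -> a = 0.
Implicit Types L M N : set A.

Lemma tau_represents (psi : {scalar A}) : exists a, forall b, psi b = tau (b * a).
Proof.
pose b := vbasis {:A}; pose n := \dim {:A}.
pose G : 'M[K]_n := \matrix_(i, j) tau (b`_j * b`_i).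
have Gv (v : 'rV[K]_n) j : (v *m G) 0 j = tau (b`_j * \sum_i v 0 i *: b`_i).
  rewrite mxE mulr_sumr linear_sum; apply: eq_bigr => i _.
  by rewrite mxE -scalerAr linearZ.
have ext (f g : {scalar A}) : (forall j : 'I_n, f b`_j = g b`_j) -> forall a, f a = g a.
  move=> H a; rewrite (coord_vbasis (memvf a)) !linear_sum; apply: eq_bigr => i _.
  by rewrite !linearZ /= H.
have mulr_scalar (a : A) : exists f : {scalar A}, forall x, f x = tau (x * a).
  have lin : scalar (fun x => tau (x * a)).
    by move=> k x y; rewrite mulrDl -scalerAl linearP.
  pose f : {scalar A} := HB.pack (fun x => tau (x * a)) (GRing.isLinear.Build _ _ _ _ _ lin).
  by exists f.
have Gu : G \in unitmx.
  rewrite -row_free_unit -kermx_eq0; apply/rowV0P => v /sub_kermxP vG.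
  have [f Hf] := mulr_scalar (\sum_i v 0 i *: b`_i).
  have [f0 Hf0] := mulr_scalar 0.
  have a0 : \sum_i v 0 i *: b`_i = 0.
    apply: tau_nondeg => c; rewrite -Hf (ext f f0) ?Hf0 ?mulr0 ?linear0 //.
    by move=> j; rewrite Hf Hf0 mulr0 linear0 -Gv vG mxE.
  apply/rowP => i; rewrite mxE.
  have /freeP := basis_free (vbasisP {:A}).
  by apply=> //; rewrite -[RHS]a0.
pose w : 'rV[K]_n := (\row_j psi b`_j) *m invmx G.
have [f Hf] := mulr_scalar (\sum_i w 0 i *: b`_i).
exists (\sum_i w 0 i *: b`_i) => x; rewrite -Hf; apply: ext => j.
by rewrite Hf -Gv /w mulmxKV // mxE.
Qed.

(** The factor [z] is absorbed into [tau], which becomes x ↦ tr(z x) in the application. *)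
Definition dual L : set A := [set a | forall l, L l -> R (tau (l * a))].

Lemma dual_sub L M : L `<=` M -> dual M `<=` dual L.
Proof. by move=> LM a Ma l /LM; exact: Ma. Qed.

Lemma dual_submodule L : submodule R (dual L).
Proof.
split.
- by move=> l _; rewrite mulr0 linear0; exact: (dvr0 HR).
- by move=> x y Hx Hy l Ll; rewrite mulrBr linearB; apply: (dvrB HR); [exact: Hx|exact: Hy].
- by move=> r x Rr Hx l Ll; rewrite -scalerAr linearZ; apply: (dvrM HR) => //; exact: Hx.
Qed.

Lemma dual_dual L : lattice R L -> (forall x, exists n, L (pi ^+ n *: x)) ->
  dual (dual L) = L.
Proof.
move=> HL Lfull; apply/seteqP; split; last first.
  by move=> x Lx l Dl; rewrite tauC; exact: Dl.
move=> x Hx; apply: contrapT => Lx.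
have [psi [psiL psix]] := lattice_sep HR HL Lfull Lx.
have [a Ha] := tau_represents psi.
apply: psix; rewrite Ha tauC; apply: Hx => l Ll; rewrite -Ha; exact: psiL.
Qed.

Lemma lattice_scale L N n : lattice R L -> submodule R N ->
  (forall x, N x -> L (pi ^+ n *: x)) -> lattice R N.
Proof.
move=> [_ [s Ls]] HN NL; split=> //; exists [seq pi ^- n *: x | x <- s] => x /NL/Ls sx.
rewrite -[x](scalerK (uniX_neq0 HR n)).
elim: s (_ *: x) {Ls} sx => [|y s IH] z /=; first by move=> ->; rewrite scaler0.
case=> c Rc /IH; rewrite scalerBr => Hz; exists c => //.
by rewrite scalerA mulrC -scalerA.
Qed.

End Duality.

(** * Central idempotents modulo the radical *)

Lemma commutator1B (A : nzRingType) (c x : A) : (1 - c) * x - x * (1 - c) = - (c * x - x * c).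
Proof.
by rewrite mulrBl mulrBr mul1r mulr1 !opprB [x * c - x]addrC addrACA subrr add0r addrC.
Qed.

Section CentralIdempotents.
Variables (K : fieldType) (R : set K) (pi : K) (HR : dvr_spec R pi).
Variables (A : falgType K) (S : set A) (HS : order_with R 1 S).
Notation J := (jacobson S).

Let Ssm : submodule R S. Proof. by case: (ord_lattice HS). Qed.
Let Jsm : submodule R J := jac_submodule HS.
Let SM := ordM HS.
Let S1 := ord_one HS.
Let Ml s x : S s -> J x -> J (s * x) := @jac_mull _ _ _ _ _ HS s x.
Let Mr x s : S s -> J x -> J (x * s) := @jac_mulr _ _ _ HR _ _ _ HS x s.

Lemma central_idem_mul a b : central_idem_mod S J a -> central_idem_mod S J b ->
  central_idem_mod S J (a * b).
Proof.
move=> [Sa aa ax] [Sb bb bx]; split; first exact: SM.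
  have -> : a * b * (a * b) - a * b =
      a * (b * a - a * b) * b + (a * a - a) * (b * b) + a * (b * b - b).
    rewrite !(mulrBr, mulrBl) !mulrA.
    by rewrite !addrA !subrK.
  apply: (submodD Jsm); first apply: (submodD Jsm).
  - by apply: Mr => //; apply: Ml => //; exact: bx.
  - by apply: Mr => //; exact: SM.
  - exact: Ml.
move=> x Sx; have -> : a * b * x - x * (a * b) = a * (b * x - x * b) + (a * x - x * a) * b.
  by rewrite mulrBr mulrBl !mulrA addrA subrK.
by apply: (submodD Jsm); [apply: Ml => //; exact: bx|apply: Mr => //; exact: ax].
Qed.

(** The decomposition of 1 along an ideal and its complement is central because c x - x c = c x d -
    d x c, and both products lie in J. *)
Lemma central_idem_ideal I N c d : twosided_ideal S I -> left_ideal S N -> J `<=` I ->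
  (forall a n, I a -> N n -> J (a * n)) -> (forall a n, I a -> N n -> J (n * a)) ->
  I c -> N d -> 1 = c + d -> central_idem_mod S J c /\ central_idem_mod S J d.
Proof.
move=> [[IS _ IM] Ir] [NS _ NM] JI IN NI Ic Nd e.
have [Sc Sd] := (IS _ Ic, NS _ Nd).
have cx x : S x -> J (c * x - x * c).
  move=> Sx; have -> : c * x - x * c = c * x * d - d * (x * c).
    have -> : d = 1 - c by rewrite e addrC addKr.
    by rewrite mulrBr mulrBl mulr1 mul1r !mulrA opprB addrA subrK.
  apply: (submodB Jsm); first by apply: IN => //; apply: Ir.
  by apply: NI => //; exact: IM.
split; split=> //.
- have -> : c * c - c = - (c * d).
    by rewrite -[X in _ - X]mulr1 e mulrDr opprD addrA subrr add0r.
  by apply: (submodN Jsm); exact: IN.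
- have -> : d * d - d = - (d * c).
    by rewrite -[X in _ - X]mulr1 e mulrDr [d * c + _]addrC opprD addrA subrr add0r.
  by apply: (submodN Jsm); exact: NI.
- move=> x Sx; have -> : d = 1 - c by rewrite e addrC addKr.
  rewrite commutator1B.
  by apply: (submodN Jsm); exact: cx.
Qed.

Variables (h : nat) (e : 'I_h -> A).
Hypothesis He : orthogonal_lifts S e.

Lemma lift_mem i : S (e i). Proof. by case: He => /(_ i)[]. Qed.
Lemma lift_idem i : e i * e i = e i. Proof. by case: He => /(_ i)[]. Qed.
Lemma lift_orth i j : i != j -> e i * e j = 0. Proof. by case: He => _ + _ _; apply. Qed.
Lemma lift_notJ i : ~ J (e i). Proof. by case: He => _ _ /(_ i)[]. Qed.
Lemma lift_comm i x : S x -> J (e i * x - x * e i).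
Proof. by case: He => _ _ /(_ i)[[_ _ +] _ _] _; apply. Qed.

(** Write 1 = c + d along [D] and its complement modulo J. By primitivity one of [e i * c],
    [e i * d] is in J. The first would put [x * e i] into J, because [x * d] is there; so the second
    is, and [e i] is in [D]. *)
Lemma ideal_mem_lift D x i : twosided_ideal S D -> J `<=` D -> D x ->
  ~ J (x * e i) -> D (e i).
Proof.
move=> HD JD Dx Jxe; have [[DS [D0 DB] DM] Dr] := HD.
have [N [HN JN [c [d [Dc Nd cd]]] DN ND]] := jac_complement2 HR HS HD JD.
have [Hc Hd] := central_idem_ideal HD HN JD DN ND Dc Nd cd.
have [Sc _ cx] := Hc; have [Sd _ _] := Hd.
have [_ _ /(_ i)[Hei _ prim] _] := He; have Sei := lift_mem i.
have [] := prim _ _ (central_idem_mul Hei Hc) (central_idem_mul Hei Hd).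
- have -> : e i * c * (e i * d) = e i * (c * (e i * d)) by rewrite !mulrA.
  apply: Ml => //; apply: DN => //; case: HN => _ _; exact.
- by rewrite -mulrDr -cd mulr1 subrr; exact: (submod0 Jsm).
- move=> Jec; exfalso; apply: Jxe.
  have -> : x * e i = x * d * e i + x * (c * e i - e i * c) + x * (e i * c).
    rewrite mulrBr addrA subrK -mulrA -mulrDr -mulrDl [d + c]addrC -cd mul1r //.
  have Sx := DS _ Dx; apply: (submodD Jsm); last exact: Ml.
  by apply: (submodD Jsm); [apply: Mr => //; exact: DN|apply: Ml => //; exact: cx].
- move=> Jed; have -> : e i = e i * c + e i * d by rewrite -mulrDr -cd mulr1.
  rewrite -[e i * d]opprK; apply: DB; first exact: DM.
  by apply: JD; apply: (submodN Jsm).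
Qed.

Lemma sum_lifts_mull (P : pred 'I_h) i : e i * (\sum_(j | P j) e j) = if P i then e i else 0.
Proof.
rewrite mulr_sumr (eq_bigr (fun j => if j == i then e i else 0)).
  by rewrite -big_mkcondr; case: ifP => Pi; [rewrite (big_pred1 i) // => j /=|rewrite big_pred0 // => j /=];
    case: eqVneq => [->|]; rewrite ?Pi ?andbF.
by move=> j _; case: eqVneq => [->|]; [exact: lift_idem|rewrite eq_sym => /lift_orth].
Qed.

Lemma sum_lifts_mul (P Q : pred 'I_h) :
  (\sum_(i | P i) e i) * (\sum_(j | Q j) e j) = \sum_(i | P i && Q i) e i.
Proof.
rewrite mulr_suml big_mkcondr; apply: eq_bigr => i _; exact: sum_lifts_mull.
Qed.

Lemma sum_lifts_mem (P : pred 'I_h) : S (\sum_(i | P i) e i).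
Proof. by apply: (submod_sum Ssm) => i _; exact: lift_mem. Qed.

Lemma sum_lifts_comm (P : pred 'I_h) x : S x ->
  J ((\sum_(i | P i) e i) * x - x * (\sum_(i | P i) e i)).
Proof.
move=> Sx; rewrite mulr_suml mulr_sumr -sumrB; apply: (submod_sum Jsm) => i _.
exact: lift_comm.
Qed.

(** If the remainder [g] were not in J, a central idempotent [c] modulo J lying under [g], with S c
    + J minimal, would be primitive and so congruent to some [e i]; but [e i * g = 0] forces [c]
    into J. Hence [g] is an idempotent in J, that is 0. *)
Lemma sum_lifts1 : \sum_i e i = 1.
Proof.
set g := 1 - \sum_i e i.
have eg i : e i * g = 0.
  by rewrite mulrBr mulr1 (sum_lifts_mull xpredT) subrr.
have Sg : S g by apply: (submodB Ssm) => //; exact: sum_lifts_mem.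
have gg : g * g = g.
  by rewrite {1}/g mulrBl mul1r mulr_suml big1 ?subr0 // => i _; exact: eg.
have gcomm x : S x -> J (g * x - x * g).
  move=> Sx; rewrite commutator1B.
  by apply: (submodN Jsm); exact: sum_lifts_comm.
suff : J g by move/(jac_idem HR HS)/(_ gg)/eqP; rewrite subr_eq0 => /eqP.
apply: contrapT => Jg; clearbody g.
pose good c := [/\ central_idem_mod S J c, ~ J c & J (c - c * g)].
pose X c : set A := [set y | exists2 s, S s & J (y - s * c)].
have HX c : S c -> between R pi J (X c).
  move=> Sc; split.
  - split.
    + by exists 0; [exact: (submod0 Ssm)|rewrite mul0r subr0; exact: (submod0 Jsm)].
    + move=> x y [s Ss Jx] [t St Jy]; exists (s - t); first exact: (submodB Ssm).
      have -> : x - y - (s - t) * c = (x - s * c) - (y - t * c).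
        by rewrite mulrBl !opprB [t * c - y]addrC [RHS]addrACA [- (s * c) + _]addrC.
      exact: (submodB Jsm).
    + move=> r x Rr [s Ss Jx]; exists (r *: s); first exact: (submodZ Ssm).
      by rewrite -scalerAl -scalerBr; exact: (submodZ Jsm).
  - by move=> y Jy; exists 0; [exact: (submod0 Ssm)|rewrite mul0r subr0].
  - move=> y [s Ss Jy]; have Sy : S y.
      by rewrite -(subrK (s * c) y); apply: (submodD Ssm); [exact: (jac_sub Jy)|exact: SM].
    exact: (jac_uni HR HS Sy).
pose P Y := exists2 c, good c & Y = X c.
have [||_ [c [Hc Jc cg] ->] cmin] := @between_min _ _ _ HR _ J P Jsm.
- by move=> _ [c [[Sc _ _] _ _] ->]; exact: HX.
- exists (X g), g => //; split=> //; last by rewrite gg subrr; exact: (submod0 Jsm).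
  by split=> //; rewrite gg subrr; exact: (submod0 Jsm).
have [Sc cc cx] := Hc.
have cprim : central_prim_idem_mod S J c.
  split=> // a b Ha Hb Jab cab.
  have [Sa aa ax] := Ha; have [Sb bb bx] := Hb.
  apply: contrapT => /not_orP[Ja Jb].
  have aac : J (a - a * c).
    have -> : a - a * c = - (a * a - a) - a * b - a * (c - (a + b)).
      by rewrite mulrBr mulrDr !opprB !addrA [_ - a * b + a * a]addrAC !subrK.
    apply: (submodB Jsm); last exact: Ml.
    by apply: (submodB Jsm) => //; exact: (submodN Jsm).
  (* Minimality gives S a + J = S c + J. Then [c] is congruent to some s a, so c b ≡ s a b ≡ 0, and
     [b] itself is in J. *)
  have Xac : X a = X c.
    apply: cmin.
      exists a => //; split=> //.
      have -> : a - a * g = (a - a * c) + a * (c - c * g) - (a - a * c) * g.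
        by rewrite mulrBr mulrBl opprB !mulrA !addrA !subrK.
      apply: (submodB Jsm); last exact: Mr.
      by apply: (submodD Jsm) => //; exact: Ml.
    move=> y [s Ss Jy]; exists (s * a); first exact: SM.
    have -> : y - s * a * c = (y - s * a) + s * (a - a * c).
      by rewrite mulrBr mulrA addrA subrK.
    by apply: (submodD Jsm) => //; exact: Ml.
  have [s Ss Jcs] : X a c.
    by rewrite Xac; exists 1; rewrite // mul1r subrr; exact: (submod0 Jsm).
  have Jcb : J (c * b).
    have -> : c * b = (c - s * a) * b + s * (a * b) by rewrite mulrBl mulrA subrK.
    by apply: (submodD Jsm); [exact: Mr|exact: Ml].
  apply: Jb; have -> : b = c * b - (c - (a + b)) * b - a * b - (b * b - b).
    by rewrite mulrBl subKr mulrDl [a * b + b * b]addrC addrK subKr.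
  do 3?[apply: (submodB Jsm) => //]; exact: Mr.
have [_ _ _ /(_ c cprim)[i Jci]] := He.
apply: Jc; have -> : c = (c - c * g) + (c - e i) * g.
  by rewrite mulrBl eg subr0 subrK.
by apply: (submodD Jsm) => //; exact: Mr.
Qed.

End CentralIdempotents.

(** * Symmetric orders *)

Section SymmetricOrder.
Variables (K : fieldType) (R : set K) (pi : K) (HR : dvr_spec R pi).
Variables (A : falgType K) (tau : {scalar A}).
Hypothesis tauC : forall a b, tau (a * b) = tau (b * a).
Hypothesis tau_nondeg : forall a, (forall b, tau (b * a) = 0) -> a = 0.
Variable L : set A.
Hypothesis HL : order_with R 1 L.
Hypothesis Lfull : forall a, exists n, L (pi ^+ n *: a).
Hypothesis Ldual : dual R tau L = L.
Hypothesis Lindec : indecomposable L.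
Hypothesis Lnonhered : ~ hereditary L.
Hypothesis Ass : semisimple_algebra A.
Variables (h : nat) (e : 'I_h -> A).
Hypothesis He : orthogonal_lifts L e.

(* L is Λ; G = J(Λ)^# is shown to be Γ = Id(J(Λ)) in idealizer_jac. *)
Notation J := (jacobson L).
Notation G := (dual R tau J).
Notation J' := (jacobson G).
Notation dual := (dual R tau).

Let Lsm : submodule R L. Proof. by case: (ord_lattice HL). Qed.
Let Jsm : submodule R J := jac_submodule HL.
Let LM := ordM HL.
Let L1 := ord_one HL.
Let JL : J `<=` L. Proof. exact: jac_sub. Qed.
Let JMl s x : L s -> J x -> J (s * x). Proof. exact: (jac_mull HL). Qed.
Let JMr x s : L s -> J x -> J (x * s).
Proof. by move=> Ls Jx; exact: (jac_mulr HR HL Ls Jx). Qed.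
Let Gsm : submodule R G := dual_submodule HR tau J.

Lemma tau_int x : L x -> R (tau x).
Proof. by rewrite -{1}Ldual => Lx; rewrite -[x]mul1r; exact: Lx. Qed.

Lemma mem_dualP x : (forall l, L l -> R (tau (l * x))) -> L x.
Proof. by rewrite -[X in X x]Ldual. Qed.

(** Only one off-diagonal block is assumed to vanish; symmetry and nondegeneracy of the form kill
    the opposite block. So [c] is central, and c Λ and (1 - c) Λ decompose Λ. *)
Lemma central_idem_trivial c : L c -> c * c = c ->
  (forall x, L x -> c * x * (1 - c) = 0) -> c = 0 \/ c = 1.
Proof.
move=> Lc cc H; have H1 a : c * a * (1 - c) = 0.
  have [n Ln] := Lfull a; apply: (scalerI (uniX_neq0 HR n)).
  by rewrite scaler0 scalerAl scalerAr H.
have H2 a : (1 - c) * a * c = 0.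
  apply: tau_nondeg => b; rewrite mulrA tauC !mulrA.
  by rewrite H1 !mul0r linear0.
have comm a : c * a = a * c.
  have := H1 a; rewrite mulrBr mulr1 => /eqP; rewrite subr_eq0 => /eqP ->.
  have := H2 a; rewrite !mulrBl mul1r => /eqP; rewrite subr_eq0 => /eqP <-.
  by [].
pose I : set A := [set x | L x /\ c * x = x].
pose I' : set A := [set x | L x /\ c * x = 0].
have HI : twosided_ideal L I.
  split; first split.
  - by move=> x [].
  - split; first by split; [exact: (submod0 Lsm)|rewrite mulr0].
    by move=> x y [Lx cx] [Ly cy]; split; [exact: (submodB Lsm Lx Ly)|rewrite mulrBr cx cy].
  - by move=> s x Ls [Lx cx]; split; [exact: LM|rewrite mulrA comm -mulrA cx].
  - by move=> s x Ls [Lx cx]; split; [exact: LM|rewrite mulrA cx].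
have HI' : twosided_ideal L I'.
  split; first split.
  - by move=> x [].
  - split; first by split; [exact: (submod0 Lsm)|rewrite mulr0].
    by move=> x y [Lx cx] [Ly cy]; split; [exact: (submodB Lsm Lx Ly)|rewrite mulrBr cx cy subrr].
  - by move=> s x Ls [Lx cx]; split; [exact: LM|rewrite mulrA comm -mulrA cx mulr0].
  - by move=> s x Ls [Lx cx]; split; [exact: LM|rewrite mulrA cx mul0r].
have [||I0|I0] := Lindec HI HI'.
- apply/seteqP; split=> [_ [x [Lx _] [y [Ly _] ->]]|x Lx]; first exact: (submodD Lsm Lx Ly).
  exists (c * x); first by split; [exact: LM|rewrite mulrA cc].
  exists (x - c * x); last by rewrite addrC subrK.
  by split; [apply: (submodB Lsm) => //; exact: LM|rewrite mulrBr mulrA cc subrr].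
- apply/seteqP; split=> [x [[_ cx] [_ cx0]]|x /= ->]; first by rewrite -cx cx0.
  by split; split; rewrite ?mulr0 //; exact: (submod0 Lsm).
- left; have : I c by split.
  by rewrite I0.
- right; have : I' (1 - c) by split; [exact: (submodB Lsm)|rewrite mulrBr mulr1 cc subrr].
  by rewrite I0 => /= /eqP; rewrite subr_eq0 => /eqP.
Qed.

(** * The dual of the radical and its identification with Γ *)

Lemma sub_jac_dual x : L x -> G x.
Proof. by move=> Lx j Jj; apply: tau_int; apply: LM => //; exact: JL. Qed.

Lemma jac_dual_mul j y : J j -> G y -> L (j * y).
Proof. by move=> Jj Gy; apply: mem_dualP => l Ll; rewrite mulrA; apply: Gy; exact: JMl. Qed.

Lemma dual_jac_mul y j : G y -> J j -> L (y * j).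
Proof.
by move=> Gy Jj; apply: mem_dualP => l Ll; rewrite tauC -mulrA tauC; apply: Gy; exact: JMr.
Qed.

(** The form moves the commutator to the other factor: τ(l [c, y]) = -τ([c, l] y), where [c, l] is
    in J and [y] in J^#. *)
Lemma comm_jac_dual c y : L c -> (forall x, L x -> J (c * x - x * c)) -> G y ->
  L (c * y - y * c).
Proof.
move=> Lc Hc Gy; apply: mem_dualP => l Ll.
have -> : tau (l * (c * y - y * c)) = - tau ((c * l - l * c) * y).
  by rewrite mulrBr mulrBl !linearB opprB /= mulrA (mulrA l y) (tauC (l * y)) mulrA.
by apply: (dvrN HR); apply: Gy; exact: Hc.
Qed.

Notation es P := (\sum_(i < h | P i) e i).

Let esL P : L (es P) := sum_lifts_mem HL He P.
Let es_idem P : es P * es P = es P.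
Proof. by rewrite (sum_lifts_mul He); apply: eq_bigl => i; rewrite andbb. Qed.
Let es_orth (P Q : pred 'I_h) : (forall i, P i && Q i = false) -> es P * es Q = 0.
Proof. by move=> PQ; rewrite (sum_lifts_mul He) big_pred0. Qed.

(** For orthogonal c, d one has c z d = -c [d, z]. Applied to [y], this puts c y d into Λ; applied
    again to c y d itself, now a commutator with an element of Λ, it puts it into J. *)
Lemma offdiag_jac_dual (P Q : pred 'I_h) y : (forall i, P i && Q i = false) -> G y ->
  J (es P * y * es Q).
Proof.
move=> PQ Gy; have cd := es_orth PQ; set c := es P in cd *; set d := es Q in cd *.
have step z : c * z * d = - (c * (d * z - z * d)).
  by rewrite mulrBr mulrA cd mul0r sub0r opprK mulrA.
have Lu : L (c * y * d).
  rewrite step; apply: (submodN Lsm); apply: LM; first exact: esL.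
  by apply: comm_jac_dual => //; [exact: esL|exact: (sum_lifts_comm HL He)].
have -> : c * y * d = c * (c * y * d) * d by rewrite !mulrA es_idem -[_ * d * d]mulrA es_idem.
rewrite step; apply: (submodN Jsm); apply: JMl; first exact: esL.
exact: (sum_lifts_comm HL He).
Qed.

(* The idempotent c with J^# J = J + Λ c Λ satisfies (1 - c) Λ c = (1 - c) Λ c J,
   so c = 0 or c = 1; if c = 1 then J is left projective and Λ is hereditary. *)
Lemma jac_dual_jac y j : G y -> J j -> J (y * j).
Proof.
move: y j; pose I := set_prod G J.
have IL : I `<=` L.
  apply: set_prod_min; [exact: (submod0 Lsm)|exact: (submodD Lsm)|exact: dual_jac_mul].
have HI : twosided_ideal L I.
  have Ism : submodule R I by exact: (set_prod_submodule HR _ Gsm).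
  split; first split=> //; first by split; [exact: (submod0 Ism)|exact: (submodB Ism)].
    move=> s x Ls; move: x; apply: set_prod_mull => y Gy j Jj.
    by rewrite mulrA; apply: Gy; exact: JMr.
  move=> s x Ls; move: x; apply: set_prod_mulr => y; exact: JMr.
have JI : J `<=` I.
  by move=> j Jj; rewrite -[j]mul1r; apply: set_prod_mem => //; exact: sub_jac_dual.
pose P i := `[< I (e i) >]; pose c := es P; pose d := es (predC P).
have cd1 : c + d = 1.
  by rewrite -(sum_lifts1 HR HL He) /c /d [RHS](bigID P).
have dc : d * c = 0 by apply: es_orth => i /=; rewrite andNb.
have cd : c * d = 0 by apply: es_orth => i /=; rewrite andbN.
have Ixd x : I x -> J (x * d).
  move=> Ix; rewrite mulr_sumr; apply: (submod_sum Jsm) => i /asboolP nI.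
  by apply: contrapT => Jxe; apply: nI; exact: (ideal_mem_lift HR HL He HI JI Ix).
have Ic : I c.
  have [[_ [I0 IB] _] _] := HI; rewrite /c.
  elim/big_ind: _ => // [x y Ix Iy|i /asboolP//].
  by rewrite -[y]opprK; apply: (IB) => //; rewrite -sub0r; exact: IB.
pose M : set A := [set m | exists2 x, L x & m = d * x * c].
have M0 : M `<=` [set 0].
  apply: (jac_nakayama HR HL); first by move=> _ [x Lx ->]; do 2?[apply: LM => //]; exact: esL.
  move=> m Mm; exists 0; first exact: set_prod0.
  exists m; last by rewrite add0r.
  have [x Lx mE] := Mm.
  have mc : m * c = m by rewrite mE -mulrA es_idem.
  have dm : d * m = m by rewrite mE !mulrA es_idem.
  have Jm : J m.
    rewrite mE; apply: offdiag_jac_dual; last exact: sub_jac_dual.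
    by move=> i /=; rewrite andNb.
  suff H a : I a -> set_prod M J (m * a * c) by have := H c Ic; rewrite mc mc.
  move: a; apply: set_prod_min.
  - by rewrite mulr0 mul0r; exact: set_prod0.
  - by move=> a b; rewrite mulrDr mulrDl; exact: set_prodD.
  move=> y j Gy Jj.
  (* 1 = c + d is inserted between [y] and [j]. In the first term [m * y * c] is again in [M]; in
     the second, c y d is off-diagonal and hence in J. *)
  have -> : m * (y * j) * c = (m * y * c) * (j * c) + m * ((c * y * d) * (j * c)).
    have -> : m * (c * y * d * (j * c)) = m * y * d * (j * c) by rewrite !mulrA mc.
    by rewrite -mulrDl -mulrDr cd1 mulr1 !mulrA.
  apply: set_prodD; apply: set_prod_mem => //.
  - exists (m * y); first exact: jac_dual_mul.
    by rewrite mulrA dm.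
  - by apply: JMr; [exact: esL|].
  - apply: JMr; first by apply: LM; [exact: JL|exact: esL].
    by apply: offdiag_jac_dual => // i /=; rewrite andbN.
have [|||d0|d1] := @central_idem_trivial d.
- exact: esL.
- exact: es_idem.
- move=> x Lx; apply: M0; exists x => //; congr (_ * _).
  by rewrite -cd1 addrK.
- have c1 : c = 1 by rewrite -cd1 d0 addr0.
  exfalso; apply: Lnonhered; apply: (hereditary_jac_inv HR HL Lfull _ Ass).
  have := Ic; rewrite c1; apply: set_prod_min; [exact: set_prod0|exact: set_prodD|].
  move=> y j Gy Jj; apply: set_prod_mem => // j' Jj'; exact: jac_dual_mul.
- move=> y j Gy Jj; rewrite -[_ * _]mulr1 -d1; apply: Ixd; exact: set_prod_mem.
Qed.

(** The other side follows from [jac_dual_jac]: between two factors [j * y] stands y s j, which is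
    already in J. *)
Lemma jac_jac_dual j y : J j -> G y -> J (j * y).
Proof.
move=> Jj Gy; apply: (jac_semiprime HR HL); first exact: jac_dual_mul.
move=> s Ls; have -> : j * y * s * (j * y) = j * ((y * (s * j)) * y) by rewrite !mulrA.
by apply: JMr => //; apply: jac_dual_mul => //; apply: jac_dual_jac => //; exact: JMl.
Qed.

Lemma idealizer_jac : idealizer J = G.
Proof.
apply/seteqP; split=> [a [Ha _] j Jj|y Gy].
  by rewrite tauC; apply: tau_int; apply: JL; exact: Ha.
by split=> j Jj; [exact: jac_dual_jac|exact: jac_jac_dual].
Qed.

Lemma jac_dual_order : order_with R 1 G.
Proof.
split=> [|x y Gx Gy||x _|x _]; rewrite ?mul1r ?mulr1 //; last exact: sub_jac_dual.
- apply: (lattice_scale HR (n := 1) (ord_lattice HL)) => // x Gx.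
  rewrite expr1 -[x]mul1r scalerAl; apply: jac_dual_mul => //.
  exact: (jac_uni HR HL L1).
- by move=> j Jj; rewrite mulrA; apply: Gy; exact: jac_jac_dual.
Qed.

Let HG := jac_dual_order.
Let GM := ordM HG.
Let G1 := ord_one HG.
Let J'sm : submodule R J' := jac_submodule HG.
Let J'G : J' `<=` G. Proof. exact: jac_sub. Qed.
Let J'Ml s x : G s -> J' x -> J' (s * x). Proof. exact: (jac_mull HG). Qed.
Let J'Mr x s : G s -> J' x -> J' (x * s).
Proof. by move=> Gs J'x; exact: (jac_mulr HR HG Gs J'x). Qed.

Lemma module_full N : submodule R N -> (exists n, N (pi ^+ n *: 1)) ->
  (forall l x, L l -> N x -> N (l * x)) -> forall a, exists n, N (pi ^+ n *: a).
Proof.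
move=> Nsm [n Nn] NM a; have [m Lm] := Lfull a; exists (m + n)%N.
have -> : pi ^+ (m + n) *: a = (pi ^+ m *: a) * (pi ^+ n *: 1).
  by rewrite -scalerAl -scalerAr mulr1 scalerA -exprD.
exact: NM.
Qed.

Lemma jac_uni1 : J (pi *: 1).
Proof. exact: (jac_uni HR HL L1). Qed.

Lemma jac_dual_dual : dual G = J.
Proof.
apply: (dual_dual HR tauC tau_nondeg); first exact: (lattice_sub (ord_lattice HL)).
move=> a; have [n Ln] := Lfull a; exists n.+1.
by rewrite exprS -scalerA; exact: (jac_uni HR HL Ln).
Qed.

(** For [s] in Γ the product s j stays in J(Λ), so the required left inverse of 1 - s j already
    exists in Λ. *)
Lemma jac_sub_jac : J `<=` J'.
Proof.
move=> j Jj; apply/(jacP HR HG); split; first by apply: sub_jac_dual; exact: JL.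
move=> s Gs; have [_ /(_ 1 L1)[t Lt]] := (jacP HR HL _).1 (jac_dual_jac Gs Jj).
by rewrite mul1r => tE; exists t => //; exact: sub_jac_dual.
Qed.

Lemma mem_jacP x : (forall g, G g -> R (tau (g * x))) -> J x.
Proof. by rewrite -[X in X x]jac_dual_dual. Qed.

Lemma lift_jac' i : ~ J' (e i).
Proof.
move=> /(jac_idem HR HG)/(_ (lift_idem He i)) ei0.
by apply: (lift_notJ He (i := i)); rewrite ei0; exact: (submod0 Jsm).
Qed.

Lemma diag_decomp (P Q : pred 'I_h) x : es P * x * es Q = \sum_(i | P i) \sum_(j | Q j) e i * x * e j.
Proof.
by rewrite !mulr_suml; apply: eq_bigr => i _; rewrite mulr_sumr.
Qed.

Let offdiag1 i j y : i != j -> G y -> J (e i * y * e j).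
Proof.
move=> ij Gy; have := @offdiag_jac_dual (pred1 i) (pred1 j) y.
rewrite !big_pred1_eq; apply=> // k /=; case: eqVneq => //= ->; exact/negbTE.
Qed.

Let Jcorner i x : jacobson (corner (e i) G) x <-> [/\ J' x, e i * x = x & x * e i = x].
Proof. by apply: (jac_corner HR HG); [exact: (sub_jac_dual (lift_mem He i))|exact: (lift_idem He i)]. Qed.

Lemma hereditary_jac_dual : J' = J ->  hereditary G.
Proof.
move=> eJ; have toJ x : J' x -> J x by rewrite eJ.
have Gfull a : exists n, G (pi ^+ n *: a).
  by have [n Ln] := Lfull a; exists n; exact: sub_jac_dual.
apply: (hereditary_jac_inv HR HG Gfull _ Ass).
pose U := right_colon G J'; pose I := set_prod U J'.
have HI : twosided_ideal G I.
  have Usm : submodule R U.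
    split.
    - by move=> x _; rewrite mulr0; exact: (submod0 Gsm).
    - by move=> x y Ux Uy j Jj; rewrite mulrBr; apply: (submodB Gsm); [exact: Ux|exact: Uy].
    - by move=> r x Rr Ux j Jj; rewrite -scalerAr; apply: (submodZ Gsm) => //; exact: Ux.
  have Ism : submodule R I by exact: (set_prod_submodule HR _ Usm).
  split; first split.
  - apply: set_prod_min; [exact: (submod0 Gsm)|exact: (submodD Gsm)|].
    move=> y j Uy J'j j' Jj'; rewrite mulrA; apply: tau_int; apply: JL.
    by apply: jac_dual_jac; [apply: Uy; exact: jac_sub_jac|exact: toJ].
  - by split; [exact: (submod0 Ism)|exact: (submodB Ism)].
  - move=> s x Gs; move: x; apply: set_prod_mull => y Uy j J'j.
    by rewrite mulrA; apply: Uy; exact: J'Mr.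
  - by move=> s x Gs; move: x; apply: set_prod_mulr => y; exact: J'Mr.
have J'I : J' `<=` I.
  move=> j J'j; rewrite -[j]mul1r; apply: set_prod_mem => // j' /J'G.
  by rewrite mulr1.
have [N [HN J'N [a [n [Ia Nn e1]]] IN _]] := jac_complement2 HR HG HI J'I.
have [NG _ NM] := HN.
(* As J'^# = G, the inclusion I N <= J' dualizes to J' N <= J'^2; then N is nil modulo J'. *)
have JN j m : J' j -> N m -> set_prod J' J' (j * m).
  move=> J'j Nm; rewrite -(dual_dual HR tauC tau_nondeg (L := set_prod J' J')).
  - move=> l Dl; rewrite mulrA; apply: tau_int; apply: JL; apply: toJ; apply: IN => //.
    apply: set_prod_mem => // j' J'j' j'' Jj''; rewrite mulrA; apply: Dl.
    by apply: set_prod_mem => //; exact: jac_sub_jac.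
  - apply: lattice_sub (ord_lattice HG) _ _; first exact: (set_prod_submodule HR _ J'sm).
    apply: set_prod_min; [exact: (submod0 Gsm)|exact: (submodD Gsm)|].
    by move=> x y /J'G Gx /J'G; exact: GM.
  - apply: module_full; first exact: (set_prod_submodule HR _ J'sm).
      have J'1 := jac_sub_jac jac_uni1; exists 2%N.
      suff -> : pi ^+ 2 *: 1 = (pi *: 1) * (pi *: 1) :> A by exact: set_prod_mem.
      by rewrite -scalerAl mul1r scalerA.
    move=> l x Ll; move: x; apply: set_prod_mull => y; apply: J'Ml.
    exact: sub_jac_dual.
have JpowN k : forall m x, N m -> jac_pow G k.+1 x -> jac_pow G k.+2 (x * m).
  elim: k => [|k IH] m x Nm /=.
    move: x; apply: set_prod_min => [|x y|j g J'j Gg].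
    - by rewrite mul0r; exact: set_prod0.
    - by rewrite mulrDl; exact: set_prodD.
    have := JN j (g * m) J'j (NM _ _ Gg Nm); rewrite mulrA; move: (_ * _).
    apply: set_prod_min; [exact: set_prod0|exact: set_prodD|].
    move=> x y J'x J'y; apply: set_prod_mem => //; rewrite -[y]mulr1; exact: set_prod_mem.
  by move: x; apply: set_prod_mulr => y; exact: IH.
have NJ m : N m -> J' m.
  move=> Nm; apply: (jac_nil HR HG); first exact: NG.
  move=> s Gs; have Nsm := NM _ _ Gs Nm; move: (s * m) Nsm => {Gs Nm s m} m Nm.
  have [k Hk] := jac_pow_deep HR HG 2.
  (* The factor [pi], being in J', starts the chain of inclusions J'^(l+1) N ⊆ J'^(l+2). It costs
     one power of [pi], hence the exponent 2 above: [pi *: m ^+ k.+1] is in [pi]^2 Γ, so the power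
     of [m] is in [pi] Γ ⊆ J'. *)
  have Hpow l : jac_pow G l.+1 (pi *: m ^+ l).
    elim: l => [|l IH].
      rewrite expr0 -[_ *: 1]mulr1; apply: set_prod_mem => //.
      exact: (jac_sub_jac jac_uni1).
    by rewrite exprSr scalerAl; exact: JpowN.
  exists k; have [y Gy E] := Hk _ (jac_pow_mono HR HG (jac_pow_mono HR HG (Hpow k.+1))).
  have -> : m ^+ k.+1 = pi *: y.
    by apply: (scalerI (uni_neq0 HR)); rewrite E scalerA expr2.
  exact: (jac_uni HR HG Gy).
rewrite e1; have [[_ [I0 IB] _] _] := HI.
rewrite -[n]opprK; apply: (IB) => //; rewrite -sub0r; apply: IB => //.
by apply: J'I; exact: NJ.
Qed.

(** * Corners at idempotents of the two kinds and the dual of J(Γ) *)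

Let CL i := cornerP HL (lift_mem He i) (lift_idem He i).
Let JcornerL i x : jacobson (corner (e i) L) x <-> [/\ J x, e i * x = x & x * e i = x].
Proof. by apply: (jac_corner HR HL); [exact: (lift_mem He i)|exact: (lift_idem He i)]. Qed.

(* The corner e_i Λ e_i is simple modulo its radical. *)
Lemma corner_ideal_mem i (D : set A) x : D `<=` corner (e i) L ->
  D 0 -> (forall x y, D x -> D y -> D (x - y)) ->
  (forall s x, corner (e i) L s -> D x -> D (s * x)) ->
  (forall s x, corner (e i) L s -> D x -> D (x * s)) ->
  jacobson (corner (e i) L) `<=` D -> D x -> ~ J x -> D (e i).
Proof.
move=> DC D0 DB DMl DMr JD Dx Jx; have ei := lift_idem He i; have Lei := lift_mem He i.
have corn a : L a -> corner (e i) L (e i * a * e i) by exists a.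
have [Lx ex xe] := (CL i x).1 (DC _ Dx).
(* The largest ideal of Λ all of whose compressions to the corner lie in [D]; it carries the
   question from the corner to Λ, where [ideal_mem_lift] applies. *)
pose I : set A := [set y | L y /\ forall a b, L a -> L b -> D (e i * a * y * b * e i)].
have HI : twosided_ideal L I.
  split; first split.
  - by move=> y [].
  - split; first by split=> [|a b _ _]; [exact: (submod0 Lsm)|rewrite mulr0 !mul0r].
    move=> y z [Ly Hy] [Lz Hz]; split=> [|a b La Lb]; first exact: (submodB Lsm).
    by rewrite mulrBr !mulrBl; apply: DB; [exact: Hy|exact: Hz].
  - move=> s y Ls [Ly Hy]; split=> [|a b La Lb]; first exact: LM.
    by rewrite mulrA -[e i * a * s]mulrA; apply: Hy => //; exact: LM.
  - move=> s y Ls [Ly Hy]; split=> [|a b La Lb]; first exact: LM.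
    by rewrite mulrA -[_ * s * b]mulrA; apply: Hy => //; exact: LM.
have JI : J `<=` I.
  move=> j Jj; split=> [|a b La Lb]; first exact: JL.
  apply: JD; apply/JcornerL; split.
  - by do 2?[apply: JMr => //]; apply: JMl => //; exact: LM.
  - by rewrite !mulrA ei.
  - by rewrite -[_ * e i * e i]mulrA ei.
have Ix : I x.
  split=> // a b La Lb.
  have -> : e i * a * x * b * e i = (e i * a * e i) * x * (e i * b * e i).
    by rewrite !mulrA -[_ * e i * x]mulrA ex -[_ * x * e i]mulrA xe.
  by apply: DMr; [exact: corn|apply: DMl => //; exact: corn].
have [|_ /(_ 1 1 L1 L1)] := ideal_mem_lift HR HL He (i := i) HI JI Ix.
  by rewrite xe.
by rewrite !mulr1 !ei.
Qed.

(** The elements of e_i Λ e_i whose image under the isomorphism is represented in Λ form an ideal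
    [D] of the corner. A preimage of the class of [e i] is in [D] and not in J, so [D] contains
    [e i] and is everything; by surjectivity, every class of e_i Γ e_i has a representative in Λ. *)
Lemma corner_decomp i :
  bimod_quot_iso (corner (e i) L) (corner (e i) L) (jacobson (corner (e i) L))
         (corner (e i) G) (jacobson (corner (e i) G)) ->
  forall y, corner (e i) G y -> exists l b, [/\ L l, e i * l = l, l * e i = l, J' b & y = l + b].
Proof.
move=> [g [[gG gD gN gsurj] gl gr]].
have HC := corner_order HG (sub_jac_dual (lift_mem He i)) (lift_idem He i).
have HCL := corner_order HL (lift_mem He i) (lift_idem He i).
have CLsm : submodule R (corner (e i) L) by case: (ord_lattice HCL).
set C := corner (e i) L in gG gD gN gsurj gl gr HCL CLsm *.
set N' := jacobson (corner (e i) G) in gD gN gsurj gl gr *.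
have N'sm : submodule R N' := jac_submodule HC.
have CinG : C `<=` corner (e i) G by move=> _ [x Lx <-]; exists x => //; exact: sub_jac_dual.
pose D : set A := [set x | C x /\ exists2 l, C l & N' (g x - l)].
have DC : D `<=` C by move=> x [].
have gB x y : C x -> C y -> N' (g (x - y) - (g x - g y)).
  move=> Cx Cy; have := gD (x - y) y (submodB CLsm Cx Cy) Cy.
  by move/(submodN N'sm); rewrite subrK; congr (N' _); rewrite !opprB addrA.
have D0 : D 0.
  split; first exact: (submod0 CLsm).
  exists 0; first exact: (submod0 CLsm).
  rewrite subr0; apply/(gN _ (submod0 CLsm)); exact: (submod0 (jac_submodule HCL)).
have DB x y : D x -> D y -> D (x - y).
  move=> [Cx [l Cl Hl]] [Cy [m Cm Hm]]; split; first exact: (submodB CLsm).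
  exists (l - m); first exact: (submodB CLsm).
  have -> : g (x - y) - (l - m) = (g (x - y) - (g x - g y)) + ((g x - l) - (g y - m)).
    have -> : (g x - l) - (g y - m) = (g x - g y) - (l - m).
      by rewrite !opprB [m - _]addrC addrACA [- l + m]addrC.
    by rewrite addrA subrK.
  by apply: (submodD N'sm); [exact: gB|exact: (submodB N'sm)].
have DMl s x : C s -> D x -> D (s * x).
  move=> Cs [Cx [l Cl Hl]]; split; first exact: (ordM HCL).
  exists (s * l); first exact: (ordM HCL).
  have -> : g (s * x) - s * l = (g (s * x) - s * g x) + s * (g x - l).
    by rewrite mulrBr addrA subrK.
  by apply: (submodD N'sm); [exact: gl|apply: (jac_mull HC) => //; exact: CinG].
have DMr s x : C s -> D x -> D (x * s).
  move=> Cs [Cx [l Cl Hl]]; split; first exact: (ordM HCL).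
  exists (l * s); first exact: (ordM HCL).
  have -> : g (x * s) - l * s = (g (x * s) - g x * s) + (g x - l) * s.
    by rewrite mulrBl addrA subrK.
  by apply: (submodD N'sm); [exact: gr|apply: (jac_mulr HR HC) => //; exact: CinG].
have JD : jacobson C `<=` D.
  move=> x Jx; have Cx := jac_sub Jx; split=> //; exists 0; first exact: (submod0 CLsm).
  by rewrite subr0; apply/gN.
have [x [Dx Jx]] : exists x, D x /\ ~ J x.
  apply: contrapT => H; apply: (lift_jac' (i := i)).
  have Cei : C (e i) by exact: (ord_one HCL).
  have [x Cx Hx] := gsurj _ (CinG _ Cei).
  have Dx : D x.
    by split=> //; exists (e i) => //; rewrite -opprB; exact: (submodN N'sm).
  have Jx : jacobson C x.
    apply/JcornerL; have [_ ex xe] := (CL i x).1 Cx; split=> //.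
    by apply: contrapT => Jx; apply: H; exists x.
  have N'e : N' (e i).
    by rewrite -(subrK (g x) (e i)); apply: (submodD N'sm) => //; apply/gN.
  by have /Jcorner[] := N'e.
have De : D (e i) by exact: (corner_ideal_mem DC D0 DB DMl DMr JD Dx Jx).
move=> y Gy; have [x' Cx' Hx'] := gsurj y Gy.
have [_ [l Cl Hl]] : D x'.
  have [_ ex _] := (CL i x').1 Cx'; rewrite -ex; exact: DMr.
have [Ll el le] := (CL i l).1 Cl.
exists l, (y - l); split=> //; last by rewrite addrC subrK.
have : N' (y - l).
  have -> : y - l = (y - g x') + (g x' - l) by rewrite addrA subrK.
  exact: (submodD N'sm).
by move/Jcorner => [].
Qed.

Variable t : nat.
Hypothesis Hfirst : forall i : 'I_h, (i < t)%N -> forall y, corner (e i) G y ->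
  exists l b, [/\ L l, e i * l = l, l * e i = l, J' b & y = l + b].
Hypothesis Hsecond : forall i : 'I_h, (t <= i)%N ->
  jacobson (corner (e i) G) = jacobson (corner (e i) L).

Notation f := (es (fun i : 'I_h => (t <= i)%N)).
Notation g := (es (fun i : 'I_h => (i < t)%N)).

Let fg1 : f + g = 1.
Proof.
rewrite -(sum_lifts1 HR HL He) [RHS](bigID (fun i : 'I_h => (t <= i)%N)) /=; congr (_ + _).
by apply: eq_bigl => i; rewrite ltnNge.
Qed.
Lemma dual_jac_bimod s x : G s -> dual J' x -> dual J' (s * x) /\ dual J' (x * s).
Proof.
move=> Gs Dx; split=> b J'b; first by rewrite mulrA; apply: Dx; exact: J'Mr.
by rewrite mulrA tauC mulrA; apply: Dx; exact: J'Ml.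
Qed.

(** If [e i] were in J'^#, the decomposition l + b of e_i y e_i would make τ(y e_i) integral for all
    [y] in Γ, so [e i] would lie in Γ^# = J. *)
Lemma dual_jac_lift (i : 'I_h) : (i < t)%N -> ~ dual J' (e i).
Proof.
move=> it Dei; apply: (lift_notJ He (i := i)).
have ei := lift_idem He i; have Gei := sub_jac_dual (lift_mem He i).
apply: mem_jacP => y Gy.
have -> : tau (y * e i) = tau (e i * y * e i).
  by rewrite -{1}ei mulrA tauC mulrA.
have [|l [b [Ll el le J'b E]]] := Hfirst it (y := e i * y * e i); first by exists y.
rewrite E linearD; apply: (dvrD HR); first exact: tau_int.
have be : b * e i = b.
  by have := congr1 (fun x => x * e i) E; rewrite -mulrA ei {1}E mulrDl le => /addrI.
by rewrite -be; exact: Dei.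
Qed.

(** Off-diagonal blocks are in J. On the diagonal, e_i y e_i = l + b with [l] in the ideal D = Λ ∩
    (J'^# + J') of Λ; as [D] contains no [e i] with i < t, its elements vanish modulo J at these
    blocks. *)
Lemma dual_jac_corner y : dual J' y -> J' (g * y * g).
Proof.
move=> Dy; have Gy : G y by exact: (dual_sub jac_sub_jac).
pose D : set A := [set x | L x /\ exists2 w, dual J' w & exists2 b, J' b & x = w + b].
have Dsm := dual_submodule HR tau J'.
have HD : twosided_ideal L D.
  split; first split.
  - by move=> x [].
  - split.
      split; first exact: (submod0 Lsm).
      by exists 0; [exact: (submod0 Dsm)|exists 0; rewrite ?addr0 //; exact: (submod0 J'sm)].
    move=> x z [Lx [w Dw [b J'b xE]]] [Lz [w' Dw' [b' J'b' zE]]]; split; first exact: (submodB Lsm).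
    exists (w - w'); first exact: (submodB Dsm).
    by exists (b - b'); [exact: (submodB J'sm)|rewrite xE zE opprD addrACA].
  - move=> s x Ls [Lx [w Dw [b J'b xE]]]; split; first exact: LM.
    have Gs := sub_jac_dual Ls; exists (s * w); first by case: (dual_jac_bimod Gs Dw).
    by exists (s * b); [exact: J'Ml|rewrite xE mulrDr].
  - move=> s x Ls [Lx [w Dw [b J'b xE]]]; split; first exact: LM.
    have Gs := sub_jac_dual Ls; exists (w * s); first by case: (dual_jac_bimod Gs Dw).
    by exists (b * s); [exact: J'Mr|rewrite xE mulrDl].
have JD : J `<=` D.
  move=> j Jj; split; first exact: JL.
  exists 0; first exact: (submod0 Dsm).
  by exists j; rewrite ?add0r //; exact: jac_sub_jac.
have Dei (i : 'I_h) : (i < t)%N -> ~ D (e i).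
  move=> it [_ [w Dw [b J'b E]]]; apply: (dual_jac_lift it).
  have ei := lift_idem He i; have Gei := sub_jac_dual (lift_mem He i).
  (* From e_i = w + b one gets w e_i = (1 - b) e_i, and 1 - b has a left inverse in Γ, so [e i]
     would be in J'^#. *)
  have [s Gs sE] := ((jacP HR HG b).1 J'b).2 1 G1.
  have -> : e i = s * (w * e i).
    have -> : w * e i = (1 - 1 * b) * e i 
      by rewrite -[w](addrK b) -E mul1r !mulrBl ei mul1r.
    by rewrite mulrA sE mul1r.
  by apply: (dual_jac_bimod Gs _).1; exact: (dual_jac_bimod Gei Dw).2.
rewrite diag_decomp; apply: (submod_sum J'sm) => i it; apply: (submod_sum J'sm) => j jt.
have [<-|ij] := eqVneq i j; last by apply: jac_sub_jac; exact: offdiag1.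
have [|l [b [Ll el le J'b E]]] := Hfirst it (y := e i * y * e i); first by exists y.
rewrite E; apply: (submodD J'sm) => //; apply: jac_sub_jac.
have Dl : D l.
  split=> //; exists (e i * y * e i).
    have Gei := sub_jac_dual (lift_mem He i).
    by apply: (dual_jac_bimod Gei _).2; exact: (dual_jac_bimod Gei Dy).1.
  by exists (- b); [exact: (submodN J'sm)|rewrite E addrK].
rewrite -le; apply: contrapT => Jle; apply: (Dei i it).
exact: (ideal_mem_lift HR HL He HD JD Dl Jle).
Qed.

Lemma second_corner x : J' x -> J (f * x * f).
Proof.
move=> J'x; rewrite diag_decomp; apply: (submod_sum Jsm) => i it; apply: (submod_sum Jsm) => j jt.
have [<-|ij] := eqVneq i j; last by apply: offdiag1 => //; exact: J'G.
have ei := lift_idem He i; have Gei := sub_jac_dual (lift_mem He i).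
suff /JcornerL[] : jacobson (corner (e i) L) (e i * x * e i) by [].
rewrite -Hsecond //; apply/Jcorner; split.
- by apply: J'Mr => //; exact: J'Ml.
- by rewrite !mulrA ei.
- by rewrite -[_ * e i * e i]mulrA ei.
Qed.

Lemma f_trivial : f = 0 \/ f = 1.
Proof.
have ff : f * f = f := es_idem _; have gg : g * g = g := es_idem _.
have Gf := sub_jac_dual (esL (fun i : 'I_h => (t <= i)%N)).
have Gg := sub_jac_dual (esL (fun i : 'I_h => (i < t)%N)).
(* U = {x in g A f : J' x <= G} satisfies f J g U <= J' by dual_jac_corner and semiprimeness;
   hence U <= J^# = G, which dualizes to M <= J J' for M = f J g. *)
have UG x : x = g * x * f -> (forall b, J' b -> G (b * x)) -> G x.
  move=> xE Ux j Jj.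
  pose m := f * j * g.
  have Jm : J m by apply: JMr; [exact: esL|apply: JMl => //; exact: esL].
  have gx : g * x = x by rewrite xE !mulrA gg.
  have xf : x * f = x by rewrite xE -[_ * f * f]mulrA ff.
  have -> : tau (j * x) = tau (m * x).
    by rewrite /m -[in RHS]mulrA gx -[RHS]tauC mulrA xf tauC.
  apply: tau_int; apply: JL.
  have -> : m * x = f * (m * x) * f by rewrite -mulrA -[m * x * f]mulrA xf /m !mulrA ff.
  apply: second_corner; have J'm := jac_sub_jac Jm.
  (* The inner factor x s m is in g J'^# g ⊆ J', because J' x s m ⊆ Γ J ⊆ J. Hence (x s m) x is in Γ
     by the choice of [x], and multiplying by [m] gives an element of J'. *)
  apply: (jac_semiprime HR HG); first exact: Ux.
  move=> s Gs; have -> : m * x * s * (m * x) = m * ((x * s * m) * x) by rewrite !mulrA.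
  apply: J'Mr => //; apply: (Ux).
  have zE : x * s * m = g * (x * s * m) * g.
    by rewrite !mulrA gx /m -!mulrA gg.
  rewrite zE; apply: dual_jac_corner => b J'b.
  apply: tau_int; apply: JL.
  have -> : b * (x * s * m) = (b * x * s) * m by rewrite !mulrA.
  by apply: jac_dual_jac => //; apply: GM => //; exact: Ux.
pose M : set A := [set m | [/\ J m, f * m = m & m * g = m]].
have JJ'sm : submodule R (set_prod J J') by exact: (set_prod_submodule HR _ Jsm).
have MJJ' : M `<=` set_prod J J'.
  move=> m [Jm fm mg].
  rewrite -(dual_dual HR tauC tau_nondeg (L := set_prod J J')).
  - move=> a Da.
    have -> : tau (a * m) = tau (m * (g * a * f)).
      by rewrite !mulrA mg [RHS]tauC !mulrA fm tauC.
    have : G (g * a * f).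
      apply: UG; first by rewrite !mulrA gg -[_ * f * f]mulrA ff.
      move=> b J'b j Jj.
      have -> : tau (j * (b * (g * a * f))) = tau ((f * j) * (b * g) * a).
        by rewrite !mulrA tauC !mulrA.
      by apply: Da; apply: set_prod_mem; [apply: JMl => //; exact: esL|exact: J'Mr].
    by apply.
  - apply: (lattice_sub (ord_lattice HL)) => //.
    apply: set_prod_min; [exact: (submod0 Lsm)|exact: (submodD Lsm)|].
    by move=> x y Jx /J'G; exact: jac_dual_mul.
  - apply: module_full => //.
      exists 2%N; suff -> : pi ^+ 2 *: 1 = (pi *: 1) * (pi *: 1) :> A.
        by apply: set_prod_mem; [exact: jac_uni1|exact: (jac_sub_jac jac_uni1)].
      by rewrite -scalerAl mul1r scalerA.
    by move=> l x Ll; move: x; apply: set_prod_mull => y; exact: JMl.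
have M0 : M `<=` [set 0].
  apply: (jac_nakayama HR HG); first by move=> m [/jac_sub_jac/J'G].
  move=> m Mm; have [Jm fm mg] := Mm.
  (* Splitting f j b g with 1 = f + g in the middle leaves the factor f b g in [M] or the factor f j
     g in [M]; this is why the two-sided form of Nakayama is needed. *)
  suff H a : set_prod J J' a -> set_sum (set_prod J' M) (set_prod M J') (f * a * g).
    by have := H m (MJJ' m Mm); rewrite fm mg.
  move: a; apply: set_prod_min.
  - rewrite mulr0 mul0r; exists 0; first exact: set_prod0.
    by exists 0; [exact: set_prod0|rewrite addr0].
  - move=> a b [x Hx [y Hy ea]] [x' Hx' [y' Hy' eb]]; exists (x + x'); first exact: set_prodD.
    by exists (y + y'); [exact: set_prodD|rewrite mulrDr mulrDl ea eb addrACA].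
  - move=> j b Jj J'b; exists ((f * j) * (f * b * g)).
      apply: set_prod_mem; first by apply: J'Ml => //; exact: jac_sub_jac.
      split; [|by rewrite !mulrA ff|by rewrite -[_ * g * g]mulrA gg].
      by apply: offdiag_jac_dual; [move=> i; rewrite leqNgt andNb|exact: J'G].
    exists ((f * j * g) * (b * g)).
      apply: set_prod_mem; last exact: J'Mr.
      split; [|by rewrite !mulrA ff|by rewrite -[_ * g * g]mulrA gg].
      by apply: JMr; [exact: esL|apply: JMl => //; exact: esL].
    have -> : f * (j * b) * g = f * j * (f + g) * (b * g) by rewrite fg1 mulr1 !mulrA.
    by rewrite mulrDr mulrDl !mulrA.
apply: central_idem_trivial => //.
move=> x Lx; have -> : 1 - f = g by rewrite -fg1 addrAC subrr add0r.
apply: M0; split; [|by rewrite !mulrA ff|by rewrite -[_ * g * g]mulrA gg].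
by apply: offdiag_jac_dual; [move=> i; rewrite leqNgt andNb|exact: sub_jac_dual].
Qed.

Lemma jac_eq_of_f1 : f = 1 -> J' = J.
Proof.
move=> f1; apply/seteqP; split; last exact: jac_sub_jac.
by move=> x /second_corner; rewrite f1 mulr1 mul1r.
Qed.

(** * The case f = 0 *)

Section FirstKind.
Hypothesis f0 : f = 0.

Let g1 : g = 1. Proof. by rewrite -fg1 f0 add0r. Qed.

Let dual_jac_sub : dual J' `<=` J'.
Proof. by move=> x /dual_jac_corner; rewrite g1 mulr1 mul1r. Qed.

(** Λ ∩ J' is an ideal of Λ containing J but no [e i], so it is killed by every [e i] modulo J, and
    these sum to 1. *)
Lemma cap_jac x : L x -> J' x -> J x.
Proof.
move=> Lx J'x; pose D : set A := [set y | L y /\ J' y].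
have HD : twosided_ideal L D.
  split; first split.
  - by move=> y [].
  - split; first by split; [exact: (submod0 Lsm)|exact: (submod0 J'sm)].
    by move=> y z [Ly J'y] [Lz J'z]; split; [exact: (submodB Lsm)|exact: (submodB J'sm)].
  - by move=> s y Ls [Ly J'y]; split; [exact: LM|apply: J'Ml => //; exact: sub_jac_dual].
  - by move=> s y Ls [Ly J'y]; split; [exact: LM|apply: J'Mr => //; exact: sub_jac_dual].
have JD : J `<=` D by move=> j Jj; split; [exact: JL|exact: jac_sub_jac].
rewrite -[x]mulr1 -(sum_lifts1 HR HL He) mulr_sumr; apply: (submod_sum Jsm) => i _.
apply: contrapT => Jxe; apply: (lift_jac' (i := i)).
by have [] : D (e i) by exact: (ideal_mem_lift HR HL He HD JD (conj Lx J'x) Jxe).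
Qed.

Lemma jac_dual_sum x : G x -> exists l w, [/\ L l, dual J' w & x = l + w].
Proof.
move=> Gx; pose Y := set_sum L (dual J').
have Dsm := dual_submodule HR tau J'.
have LY : L `<=` Y by move=> l Ll; exists l => //; exists 0; rewrite ?addr0 //; exact: (submod0 Dsm).
have YG : Y `<=` G.
  move=> _ [l Ll [w Dw ->]]; apply: (submodD Gsm); first exact: sub_jac_dual.
  exact: (dual_sub jac_sub_jac).
have Ysm : submodule R Y.
  split; first by apply: LY; exact: (submod0 Lsm).
    move=> _ _ [l Ll [w Dw ->]] [l' Ll' [w' Dw' ->]]; exists (l - l'); first exact: (submodB Lsm).
    by exists (w - w'); [exact: (submodB Dsm)|rewrite opprD addrACA].
  move=> r _ Rr [l Ll [w Dw ->]]; exists (r *: l); first exact: (submodZ Lsm).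
  by exists (r *: w); [exact: (submodZ Dsm)|rewrite scalerDr].
suff [l Ll [w Dw E]] : Y x by exists l, w.
rewrite -(dual_dual HR tauC tau_nondeg (L := Y)).
- move=> a Da; apply: Gx; apply: cap_jac.
    by apply: mem_dualP => l /LY; exact: Da.
  rewrite -(dual_dual HR tauC tau_nondeg (L := J')).
  + by move=> w Dw; apply: Da; exists 0; [exact: (submod0 Lsm)|exists w; rewrite ?add0r].
  + exact: (lattice_sub (ord_lattice HG)).
  + apply: module_full => //; first by exists 1%N; rewrite expr1; exact: (jac_sub_jac jac_uni1).
    by move=> l y Ll; apply: J'Ml; exact: sub_jac_dual.
- exact: (lattice_sub (ord_lattice HG)).
- by move=> y; have [n Ln] := Lfull y; exists n; exact: LY.
Qed.

(** For [x] in J' write x = l + w. Since [w] is in J'^# ⊆ J', also [l] is in J' ∩ Λ = J, and J ⊆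
    J'^# because Γ J ⊆ J. *)
Lemma jac_self_dual : dual J' = J'.
Proof.
apply/seteqP; split=> // x J'x; have [l [w [Ll Dw E]]] := jac_dual_sum (J'G J'x).
rewrite E; apply: (submodD (dual_submodule HR tau J')) => //.
have Jl : J l.
  apply: cap_jac => //; have -> : l = x - w by rewrite E addrK.
  by apply: (submodB J'sm) => //; exact: dual_jac_sub.
by move=> b J'b; apply: tau_int; apply: JL; apply: jac_dual_jac => //; exact: J'G.
Qed.

Lemma jac_dual_decomp : G = set_sum J' L.
Proof.
apply/seteqP; split=> [x /jac_dual_sum[l [w [Ll Dw ->]]]|_ [b J'b [l Ll ->]]].
  by exists w; [exact: dual_jac_sub|exists l => //; rewrite addrC].
by apply: (submodD Gsm); [exact: J'G|exact: sub_jac_dual].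
Qed.

Lemma idealizer_jac_jac : idealizer J' = dual (set_prod J' J').
Proof.
apply/seteqP; split=> [a [_ Ha]|a Da].
  apply: set_prod_min.
  - by rewrite mul0r linear0; exact: (dvr0 HR).
  - by move=> x y Hx Hy; rewrite mulrDl linearD; exact: (dvrD HR).
  - move=> x y J'x J'y; rewrite -mulrA; have := Ha _ J'y.
    by rewrite -{1}jac_self_dual; apply.
split=> x J'x; rewrite -jac_self_dual => b J'b.
  by rewrite mulrA tauC mulrA; apply: Da; exact: set_prod_mem.
by rewrite mulrA; apply: Da; exact: set_prod_mem.
Qed.

(** [p] chooses a representative in Λ modulo J'. Each required identity between elements of Λ is
    visible modulo J', and [cap_jac] turns it into one modulo J. *)
Lemma jac_quot_iso : alg_quot_iso R G J' L J.
Proof.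
have [|p Hp] := @choice _ _ (fun x l => G x -> L l /\ J' (x - l)).
  move=> x; have [Gx|nGx] := pselect (G x); last by exists 0.
  have [l [w [Ll Dw ->]]] := jac_dual_sum Gx; exists l => _; split=> //.
  by rewrite addrC addKr; exact: dual_jac_sub.
have pL x : G x -> L (p x) by move=> /Hp[].
have pJ x : G x -> J' (x - p x) by move=> /Hp[].
have GD := submodD Gsm.
exists p; split; first split=> //.
- move=> x y Gx Gy; apply: cap_jac.
    by apply: (submodB Lsm); [apply: pL; exact: GD|apply: (submodD Lsm); exact: pL].
  have -> : p (x + y) - (p x + p y) = (x - p x) + (y - p y) - (x + y - p (x + y)).
    by rewrite addrACA -opprD opprB [RHS]addrC addrA subrK.
  apply: (submodB J'sm); last by apply: pJ; exact: GD.
  by apply: (submodD J'sm); exact: pJ.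
- move=> x Gx; split=> [Jpx|J'x].
    rewrite -(subrK (p x) x); apply: (submodD J'sm); first exact: pJ.
    exact: jac_sub_jac.
  apply: cap_jac; first exact: pL.
  have -> : p x = x - (x - p x) by rewrite subKr.
  by apply: (submodB J'sm) => //; exact: pJ.
- move=> y Ly; exists y; first exact: sub_jac_dual.
  apply: cap_jac; first by apply: (submodB Lsm) => //; apply: pL; exact: sub_jac_dual.
  by apply: pJ; exact: sub_jac_dual.
- move=> x y Gx Gy; apply: cap_jac.
    by apply: (submodB Lsm); [apply: pL; exact: GM|apply: LM; exact: pL].
  have -> : p (x * y) - p x * p y = (x - p x) * y + p x * (y - p y) - (x * y - p (x * y)).
    by rewrite mulrBl mulrBr opprB [RHS]addrC !addrA !subrK.
  apply: (submodB J'sm); last by apply: pJ; exact: GM.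
  apply: (submodD J'sm); first by apply: J'Mr => //; exact: pJ.
  by apply: J'Ml; [apply: sub_jac_dual; exact: pL|exact: pJ].
- apply: cap_jac; first by apply: (submodB Lsm) => //; exact: pL.
  by rewrite -opprB; apply: (submodN J'sm); exact: pJ.
- move=> r x Rr Gx; have Grx : G (r *: x) by exact: (submodZ Gsm).
  apply: cap_jac; first by apply: (submodB Lsm); [exact: pL|apply: (submodZ Lsm) => //; exact: pL].
  have -> : p (r *: x) - r *: p x = r *: (x - p x) - (r *: x - p (r *: x)).
    by rewrite scalerBr opprB [RHS]addrC addrA subrK.
  by apply: (submodB J'sm); [apply: (submodZ J'sm) => //; exact: pJ|exact: pJ].
Qed.

End FirstKind.

End SymmetricOrder.

Lemma is_order_spec (K : fieldType) (R : set K) (pi : K) (A : falgType K) (S : set A) :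
  dvr_spec R pi -> is_order R S ->
  order_with R 1 S /\ forall a, exists n, S (pi ^+ n *: a).
Proof.
move=> HR [S1 SB SM [s [sV SE]]].
have {}SE : S = rspan R s.
  by rewrite SE; apply/seteqP; split=> a; [move/(rspanP HR)|move/(rspanP HR)].
have HS := rspan_submodule HR s; rewrite -SE in HS; split.
  by split=> // [|x _|x _]; rewrite ?mul1r ?mulr1 //; split=> //; exists s; rewrite SE.
by move=> a; rewrite SE; apply: (rspan_full HR); rewrite sV memvf.
Qed.

Section TwistedTrace.
Variables (K : fieldType) (A : falgType K) (tr : A -> K) (z : A).
Hypotheses (tr_red : is_reduced_trace tr) (z_center : z \in 'Z({:A})%VS)
  (z_unit : z \is a GRing.unit).

(** Centrality of [z] preserves the symmetry of the reduced trace form, invertibility its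
    nondegeneracy. *)
Lemma twisted_trace_spec : exists tau : {scalar A},
  [/\ forall a, tau a = tr (z * a), forall a b, tau (a * b) = tau (b * a)
    & forall a, (forall b, tau (b * a) = 0) -> a = 0].
Proof.
have [trlin trC trnd] := reduced_trace_spec tr_red.
have lin : scalar (fun a => tr (z * a)).
  by move=> c a b; rewrite mulrDr -scalerAr trlin.
pose tau : {scalar A} := HB.pack (fun a => tr (z * a)) (GRing.isLinear.Build _ _ _ _ _ lin).
have zC a : z * a = a * z.
  by move: z_center; rewrite memv_cap => /andP[_ /centvP/(_ a (memvf a))].
have tauC a b : tr (z * (a * b)) = tr (z * (b * a)).
  by rewrite mulrA trC mulrA -zC -mulrA.
exists tau; split=> // a H; apply: (mulrI z_unit); rewrite mulr0; apply: trnd => b.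
by rewrite -mulrA tauC; exact: H.
Qed.

End TwistedTrace.

Theorem theorem6p4 (K : fieldType) (R : set K) (A : falgType K)
    (tr : A -> K) (z : A) (Lambda Gamma Delta : set A)
    (h t : nat) (e : 'I_h -> A) (f : A)
    (R_dvr : is_dvr R)
    (A_sep : separable_algebra A)
    (tr_red : is_reduced_trace tr)
    (z_center : z \in 'Z({:A})%VS) (z_unit : z \is a GRing.unit)
    (Lambda_order : is_order R Lambda)
    (Lambda_indec : indecomposable Lambda)
    (Lambda_nonhered : ~ hereditary Lambda)
    (Lambda_sym : Lambda = dual_lattice R tr z Lambda)
    (Gamma_def : Gamma = idealizer (jacobson Lambda))
    (Delta_def : Delta = idealizer (jacobson Gamma))
    (e_lifts : orthogonal_lifts Lambda e)
    (t_le_h : (t <= h)%N)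
    (e_first : forall i : 'I_h, (i < t)%N ->
       bimod_quot_iso (corner (e i) Lambda)
         (corner (e i) Lambda) (jacobson (corner (e i) Lambda))
         (corner (e i) Gamma) (jacobson (corner (e i) Gamma)))
    (e_second : forall i : 'I_h, (t <= i)%N ->
       jacobson (corner (e i) Gamma) = jacobson (corner (e i) Lambda))
    (f_def : f = \sum_(i < h | (t <= i)%N) e i) :
  [/\ f = 0 \/ f = 1,
      f = 1 ->
        [/\ jacobson Gamma = jacobson Lambda, Gamma = Delta & hereditary Gamma]
    & f = 0 ->
        [/\ Gamma = set_sum (jacobson Gamma) Lambda,
            alg_quot_iso R Gamma (jacobson Gamma) Lambda (jacobson Lambda),
            jacobson Gamma = dual_lattice R tr z (jacobson Gamma)
          & Delta = dual_lattice R tr z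
                      (set_prod (jacobson Gamma) (jacobson Gamma))]].
Proof.
have [pi HR] := is_dvrP R_dvr.
have [HL Lfull] := is_order_spec HR Lambda_order.
have [tau [tauE tauC tau_nd]] := twisted_trace_spec tr_red z_center z_unit.
have dE M : dual_lattice R tr z M = dual R tau M.
  apply/seteqP; split=> a Ha l Ml; first by rewrite tauE mulrA; exact: Ha.
  by rewrite -mulrA -tauE; exact: Ha.
have Ldual : dual R tau Lambda = Lambda by rewrite -dE -Lambda_sym.
have [Ass _] := A_sep.
have GE : Gamma = dual R tau (jacobson Lambda).
  rewrite Gamma_def.
  exact: (idealizer_jac HR tauC tau_nd HL Lfull Ldual Lambda_indec Lambda_nonhered Ass e_lifts).
rewrite !dE Delta_def f_def; move: Gamma_def e_first e_second; rewrite GE => Gamma_def e_first e_second.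
have Hfirst (i : 'I_h) (it : (i < t)%N) := corner_decomp HR tauC tau_nd HL Lfull Ldual
  Lambda_indec Lambda_nonhered Ass e_lifts (e_first i it).
split.
- exact: (f_trivial HR tauC tau_nd HL Lfull Ldual Lambda_indec Lambda_nonhered Ass e_lifts Hfirst e_second).
- move=> f1; have JE := jac_eq_of_f1 HR tauC tau_nd HL Lfull Ldual Lambda_indec Lambda_nonhered
    Ass e_lifts e_second f1.
  split=> //; first by rewrite JE.
  exact: (hereditary_jac_dual HR tauC tau_nd HL Lfull Ldual Lambda_indec Lambda_nonhered Ass e_lifts JE).
- move=> f0; split.
  + exact: (jac_dual_decomp HR tauC tau_nd HL Lfull Ldual Lambda_indec Lambda_nonhered Ass e_lifts Hfirst f0).
  + exact: (jac_quot_iso HR tauC tau_nd HL Lfull Ldual Lambda_indec Lambda_nonhered Ass e_lifts Hfirst f0).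
  + by rewrite (jac_self_dual HR tauC tau_nd HL Lfull Ldual Lambda_indec Lambda_nonhered Ass e_lifts Hfirst f0).
  + exact: (idealizer_jac_jac HR tauC tau_nd HL Lfull Ldual Lambda_indec Lambda_nonhered Ass e_lifts Hfirst f0).
Qed.
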